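(* Let $n\in\mathbb{N}$ and let $|\cdot|_a$ be a norm on $\mathbb{R}^n$ such that the unit sphere of $|\cdot|_a$ contains a point which is not an extremal point of the closed unit ball of $|\cdot|_a$. Let $X=([-1,1]^n,|\cdot|_a)$, let $m\ge n$ and let $|\cdot|_b$ be an arbitrary norm on $\mathbb{R}^m$. For $\Delta\ge 0$, the set \[\{f\in\textnormal{Lip}_1(X,(\mathbb{R}^m,|\cdot|_b)) : \mathcal{H}^n(f(X))>\Delta\}\] is residual in $\textnormal{Lip}_1(X,(\mathbb{R}^m,|\cdot|_b))$ if and only if $\Delta=0$.
   Context: $\textnormal{Lip}_1(X,Y)$ is the set of bounded $1$-Lipschitz maps $X\to Y$ with the supremum metric; a set is residual if it contains a countable intersection of open dense sets. $\mathcal{H}^n$ denotes the $n$-dimensional Hausdorff measure on $\mathbb{R}^m$ (with respect to the Euclidean distance). A point $u$ of a convex set $K$ is extremal if $u+v\in K$ and $u-v\in K$ imply $v=0$. *)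

(* Defs.v *)
From HB Require Import structures.
From mathcomp Require Import all_boot all_order all_algebra.
From mathcomp Require Import all_classical all_reals all_analysis.
Set Implicit Arguments. Unset Strict Implicit. Unset Printing Implicit Defensive.
Import Order.TTheory GRing.Theory Num.Theory.
Local Open Scope classical_set_scope.
Local Open Scope ring_scope.

Section Defs.
Variable R : realType.

Definition is_norm (k : nat) (N : 'rV[R]_k -> R) : Prop :=
  [/\ (forall x, 0 <= N x),
      (forall x, N x = 0 -> x = 0),
      (forall (a : R) x, N (a *: x) = `|a| * N x) &
      (forall x y, N (x + y) <= N x + N y)].

Definition unit_ball (k : nat) (N : 'rV[R]_k -> R) : set 'rV[R]_k :=
  [set x | N x <= 1].

Definition extremal (k : nat) (K : set 'rV[R]_k) (u : 'rV[R]_k) : Prop :=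
  K u /\ forall v, K (u + v) -> K (u - v) -> v = 0.

Definition cube (k : nat) : set 'rV[R]_k :=
  [set x | forall i, -1 <= x ord0 i <= 1].

(* Lip_1(X,Y) with X = ([-1,1]^n, Na), Y = (R^m, Nb); maps are represented by
   functions on R^n, only their values on the cube matter. *)
Definition Lip1 (n m : nat) (Na : 'rV[R]_n -> R) (Nb : 'rV[R]_m -> R)
  : set ('rV[R]_n -> 'rV[R]_m) :=
  [set f | (exists M : R, forall x, cube x -> Nb (f x) <= M) /\
           (forall x y, cube x -> cube y -> Nb (f x - f y) <= Na (x - y))].

Definition supdist (n m : nat) (Nb : 'rV[R]_m -> R)
  (f g : 'rV[R]_n -> 'rV[R]_m) : R :=
  sup [set Nb (f x - g x) | x in @cube n].

Definition open_in (T : Type) (L : set T) (d : T -> T -> R) (U : set T) :=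
  U `<=` L /\
  forall f, U f -> exists2 r : R, 0 < r & forall g, L g -> d f g < r -> U g.

Definition dense_in (T : Type) (L : set T) (d : T -> T -> R) (U : set T) :=
  U `<=` L /\
  forall f, L f -> forall r : R, 0 < r -> exists g, U g /\ d f g < r.

Definition residual_in (T : Type) (L : set T) (d : T -> T -> R) (S : set T) :=
  exists U : nat -> set T,
    (forall k, open_in L d (U k) /\ dense_in L d (U k)) /\
    \bigcap_k U k `<=` S.

Definition eucl_dist (k : nat) (x y : 'rV[R]_k) : R :=
  Num.sqrt (\sum_(i < k) (x ord0 i - y ord0 i) ^+ 2).

(* Euclidean diameter (extended real; 0 for the empty set) *)
Definition diam (k : nat) (E : set 'rV[R]_k) : \bar R :=
  maxe 0%E (ereal_sup [set (eucl_dist x y)%:E | x in E & y in E]).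

Definition diam_pow (k s : nat) (E : set 'rV[R]_k) : \bar R :=
  if asbool (E = set0) then 0%E else ((fine (diam E)) ^+ s)%:E.

Definition hausdorff_pre (k s : nat) (delta : R) (A : set 'rV[R]_k) : \bar R :=
  ereal_inf [set (\sum_(0 <= i <oo) diam_pow s (E i))%E
            | E in [set E : nat -> set 'rV[R]_k |
                     A `<=` \bigcup_i E i /\ forall i, (diam (E i) <= delta%:E)%E]].

(* s-dimensional Hausdorff measure (unnormalized) *)
Definition hausdorff (k s : nat) (A : set 'rV[R]_k) : \bar R :=
  ereal_sup [set hausdorff_pre s delta A | delta in [set d : R | 0 < d]].

End Defs.

(* Main.v *)
(* If Delta = 0, consider the maps f that, on some cube of half-side s centred
   at 0 and after composition with a linear map to R^n, stay at distance less
   than s from a translation.  They form an open set, dense because a logarithmic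
   cutoff makes any map constant near 0 at almost no cost for its Lipschitz
   constant, leaving room for a small linear injection.  By a Poincare-Miranda
   argument the linear image of f(X) contains a cube up to closure, hence f(X)
   has positive measure.

   If Delta > 0, let u = (p + q) / 2 be a point of the unit sphere with p != q in
   the unit ball, let b be the Busemann function of the ray R_+ u, which has slope
   1 in both directions p and q, and let w be a strongly exposed point of the unit
   ball of |.|_b.  A map f close to f0 = b w must be stretched almost maximally
   along most small steps h p and h q, whence
   f(x + h p) ~ f(x) + h w ~ f(x + h q): f almost collapses the direction p - q and
   f(X) is covered by few small balls.  So no map in a ball around f0 has an image
   of measure greater than Delta, and Baire's theorem excludes residuality. *)
Require Import Defs.
From HB Require Import structures.
From mathcomp Require Import all_boot all_order all_algebra all_fingroup.
From mathcomp Require Import finmap.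
From mathcomp Require Import all_classical all_reals all_analysis.
From mathcomp Require Import ring lra zify.
Import Order.TTheory GRing.Theory Num.Theory.
Import numFieldNormedType.Exports.
Set Implicit Arguments. Unset Strict Implicit. Unset Printing Implicit Defensive.
Local Open Scope classical_set_scope.
Local Open Scope ring_scope.

(** The supremum distance gives no control of derivatives; this obstacle shapes the case Delta > 0.
    It is met by counting points of a lattice of mesh [t]. Along a lattice line, the defect between
    the length travelled and [psi (f x)] is monotone and confined to an interval of length [2 * r],
    where [r] bounds the distance from [f] to [f0]. So the share of lattice points with a defective
    move of at most [k] steps is of order [k ^+ 2 * r], whatever [t] is. Hence the order of the
    choices: [k] from Delta, [r] from [k], and only then [t], which depends on the scale of the
    Hausdorff premeasure. One ball around [f0] thus serves all scales. For Delta = 0, determinants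
    over Kuhn's simplices act as a degree, and volumes are compared by counting grid points. This
    yields preimages up to an arbitrarily small error; covers of the image are made finite by
    compactness, so that the error can be taken below all their radii. *)

Section Norms.
Variable R : realType.

Lemma coord_le_norm k (x : 'rV[R]_k) i : `|x ord0 i| <= `|x|.
Proof.
rewrite [leRHS]/Num.norm /= mx_normrE.
exact: (le_bigmax _ (fun ij : 'I_1 * 'I_k => `|x ij.1 ij.2|) (ord0, i)).
Qed.

Lemma norm_le_coord k (x : 'rV[R]_k) (c : R) :
  0 <= c -> (forall i, `|x ord0 i| <= c) -> `|x| <= c.
Proof.
move=> c0 xc; rewrite /Num.norm /= mx_normrE; apply/bigmax_leP; split=> // -[i j] _ /=.
by rewrite (ord1 i).
Qed.

Lemma cubeE k (x : 'rV[R]_k) : cube x <-> `|x| <= 1.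
Proof.
split=> [cx|x1 i]; last first.
  by rewrite -ler_norml (le_trans (coord_le_norm _ _)).
by apply: norm_le_coord => // i; rewrite ler_norml; exact: cx.
Qed.

Lemma norm_mulmx_le k l (A : 'M[R]_(k, l)) :
  exists2 C : R, 0 < C & forall x : 'rV[R]_k, `|x *m A| <= C * `|x|.
Proof.
exists (1 + \sum_i \sum_j `|A i j|).
  by rewrite ltr_pwDl// sumr_ge0// => i _; rewrite sumr_ge0.
move=> x; apply: norm_le_coord => [|j].
  by rewrite mulr_ge0// addr_ge0// sumr_ge0// => i _; rewrite sumr_ge0.
rewrite mxE (le_trans (ler_norm_sum _ _ _))// mulrDl mul1r.
apply: ler_wpDl => //; rewrite mulr_suml ler_sum// => i _.
rewrite normrM mulrC ler_pM ?coord_le_norm// (bigD1 j)//= lerDl.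
by rewrite sumr_ge0.
Qed.

Variables (k : nat) (N : 'rV[R]_k -> R).
Hypothesis hN : is_norm N.

Lemma is_norm_ge0 x : 0 <= N x. Proof. by case: hN. Qed.
Lemma is_normZ a x : N (a *: x) = `|a| * N x. Proof. by case: hN. Qed.
Lemma is_normD x y : N (x + y) <= N x + N y. Proof. by case: hN. Qed.
Lemma is_norm_eq0 x : N x = 0 -> x = 0. Proof. by case: hN => _ + _ _; apply. Qed.
Lemma is_norm0 : N 0 = 0. Proof. by rewrite -(scale0r 0) is_normZ normr0 mul0r. Qed.
Lemma is_normN x : N (- x) = N x.
Proof. by rewrite -scaleN1r is_normZ normrN1 mul1r. Qed.
Lemma is_norm_distC x y : N (x - y) = N (y - x).
Proof. by rewrite -is_normN opprB. Qed.
Lemma is_norm_distD z x y : N (x - y) <= N (x - z) + N (z - y).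
Proof. by rewrite (le_trans _ (is_normD _ _))// subrKA. Qed.
Lemma is_norm_sub x y : N x - N y <= N (x - y).
Proof. by rewrite lerBlDr -{1}(subrK y x) is_normD. Qed.

Lemma is_norm_sum (I : finType) (F : I -> 'rV[R]_k) :
  N (\sum_i F i) <= \sum_i N (F i).
Proof.
elim/big_ind2: _ => [|x a y b xa yb|//]; first by rewrite is_norm0.
by rewrite (le_trans (is_normD _ _))// lerD.
Qed.

Lemma is_norm_le : exists2 C : R, 0 < C & forall x, N x <= C * `|x|.
Proof.
exists (1 + \sum_i N (delta_mx ord0 i)).
  by rewrite ltr_pwDl// sumr_ge0// => i _; rewrite is_norm_ge0.
move=> x; rewrite {1}(row_sum_delta x) (le_trans (is_norm_sum _))//.
rewrite mulrDl mul1r ler_wpDl// mulr_suml ler_sum// => i _.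
by rewrite is_normZ mulrC ler_wpM2l ?is_norm_ge0// coord_le_norm.
Qed.

Lemma is_norm_continuous : continuous N.
Proof.
have [C C0 NC] := is_norm_le.
move=> x U /nbhs_ballP [e /= e0 eU]; apply/nbhs_ballP.
exists (e / C) => [|y]; first exact: divr_gt0.
rewrite -ball_normE /= ltr_pdivlMr// mulrC => xy; apply: eU.
rewrite -ball_normE /= (le_lt_trans _ xy)// ler_norml lerNl opprB.
by apply/andP; split; apply: le_trans (is_norm_sub _ _) _;
  rewrite (le_trans (NC _))// distrC.
Qed.

Lemma is_norm_ge : exists2 c : R, 0 < c & forall x, c * `|x| <= N x.
Proof.
pose S := [set x : 'rV[R]_k | `|x| = 1].
have cN : continuous N := is_norm_continuous.
(* In dimension 0 the sphere is empty and any constant works. *)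
have [[x0 Sx0]|S0] := pselect (exists x, S x); last first.
  exists 1 => // x; have [->|xn0] := eqVneq x 0.
    by rewrite normr0 mulr0 is_norm_ge0.
  by exfalso; apply: S0; exists (`|x|^-1 *: x); 
    rewrite /S /= normrZ normfV normr_id mulVf ?normr_eq0.
have cS : compact S.
  apply: bounded_closed_compact.
    by exists 1; split => // M M1 x; rewrite /S /= => ->; exact: ltW.
  have -> : S = (fun x => `|x|) @^-1` [set 1] by [].
  apply: preimage_closed; last exact: closed_eq.
  by move=> x _; exact: norm_continuous.
have [c] := @EVT_min_rV R k N S (ex_intro _ x0 Sx0) cS (continuous_subspaceT cN).
rewrite inE => Sc cmin; exists (N c).
  rewrite lt_def is_norm_ge0 andbT; apply/eqP => /is_norm_eq0 c0.
  by move: Sc; rewrite c0 /S /= normr0 => /esym/eqP; rewrite oner_eq0.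
move=> x; have [->|xn0] := eqVneq x 0.
  by rewrite normr0 mulr0 is_norm_ge0.
have xp : 0 < `|x| by rewrite normr_gt0.
have := cmin (`|x|^-1 *: x).
rewrite inE /S /= normrZ normfV normr_id mulVf ?normr_eq0// => /(_ erefl).
by rewrite is_normZ normfV normr_id mulrC ler_pdivlMr.
Qed.

End Norms.

(** * Kuhn's triangulation and the Poincare-Miranda theorem *)

Section KuhnSum.
Variables (R : numFieldType) (p N : nat).
Local Notation vertex := {ffun 'I_p.+1 -> nat}.

Lemma det_proportional_rows n (A : 'M[R]_n) (i1 i2 : 'I_n) (c : R) :
  i1 != i2 -> (forall j, A i1 j = c * A i2 j) -> \det A = 0.
Proof.
move=> i12 Ac; apply/eqP/det0P.
exists (delta_mx ord0 i1 - c *: delta_mx ord0 i2).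
  apply/eqP => /rowP /(_ i1); rewrite !mxE !eqxx (negPf i12) /= mulr0 subr0.
  by move/eqP; rewrite oner_eq0.
rewrite mulmxBl -scalemxAl -!rowE; apply/rowP => j.
by rewrite !mxE Ac subrr.
Qed.

(* The cofactors along row [k] sum to 0 because row [ord0] is constant, so the
   entry [A k j] may be replaced by minus the sum of the other entries of its
   row: the determinant becomes a sum over the facets of the simplex. *)
Lemma det_facet_expansion n (A : 'M[R]_n.+1) k :
  k != ord0 -> (forall j, A ord0 j = 1) ->
  \det A = - \sum_j (\sum_l A k (lift j l)) * cofactor A k j.
Proof.
move=> k0 A1; have cof0 : \sum_j cofactor A k j = 0.
  have /matrixP /(_ ord0 k) := mul_mx_adj A.
  rewrite !mxE eq_sym (negPf k0) mulr0n => adj0; rewrite -[RHS]adj0.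
  by apply: eq_bigr => j _; rewrite A1 mul1r mxE.
transitivity (- \sum_j ((\sum_l A k l) * cofactor A k j -
    A k j * cofactor A k j)); last first.
  congr (- _); apply: eq_bigr => j _; rewrite -mulrBl; congr (_ * _).
  by rewrite [X in X - _](bigD1_ord j)//= addrAC subrr add0r.
by rewrite sumrB -mulr_sumr cof0 mulr0 sub0r opprK -expand_det_row.
Qed.

(* [s] sends a coordinate to the step at which it is incremented along the path
   of vertices of the simplex. *)
Definition kuhn_vertex (x : vertex) (s : 'S_p.+1) (j : nat) : vertex :=
  [ffun i => (x i + (s i < j))%N].

Definition kuhn_mx (a : 'I_p.+2 -> vertex -> R) (x : vertex) (s : 'S_p.+1)
  : 'M[R]_p.+2 := \matrix_(r, j) a r (kuhn_vertex x s j).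

Definition grid_vertex (x : {ffun 'I_p.+1 -> 'I_N}) : vertex :=
  [ffun i => x i : nat].

(** With [a ord0] constantly 1, each determinant is a factorial times the oriented volume of the
    image of a simplex, and the signature orients all simplices alike. The sum is a discrete degree,
    governed by boundary values. *)
Definition kuhn_sum (a : 'I_p.+2 -> vertex -> R) : R :=
  \sum_(x : {ffun 'I_p.+1 -> 'I_N}) \sum_(s : 'S_p.+1)
    (-1) ^+ s * \det (kuhn_mx a (grid_vertex x) s).

Definition incr_vertex (y : vertex) (i0 : 'I_p.+1) : vertex :=
  [ffun i => (y i + (i == i0))%N].

(** The shift is realised by the cyclic successor [ordS] on coordinate [i0]; it differs from the
    increment only where it wraps around, and there both terms vanish. *)
Lemma sum_incr_vertex (G : vertex -> R) (i0 : 'I_p.+1) :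
  (forall y : vertex, y i0 = 0%N \/ y i0 = N -> G y = 0) ->
  \sum_x G (incr_vertex (grid_vertex x) i0) = \sum_x G (grid_vertex x).
Proof.
move=> G0.
pose h (x : {ffun 'I_p.+1 -> 'I_N}) : {ffun 'I_p.+1 -> 'I_N} :=
  [ffun i => if i == i0 then ordS (x i) else x i].
have h_inj : injective h.
  move=> x y /ffunP hxy; apply/ffunP => i; move: (hxy i); rewrite !ffunE.
  by case: ifP => // _ /ordS_inj.
rewrite [RHS](reindex_inj h_inj); apply: eq_bigr => x _.
have [xN|xN] := eqVneq (x i0).+1 N.
  rewrite [LHS]G0; last by right; rewrite !ffunE eqxx addn1.
  by rewrite G0//; left; rewrite !ffunE eqxx /= xN modnn.
congr G; apply/ffunP => i; rewrite !ffunE.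
case: eqVneq => [->|_] /=; last by rewrite addn0.
by rewrite addn1 modn_small// ltn_neqAle xN ltn_ord.
Qed.

(** Contribution to [det_facet_expansion] of the facet opposite to vertex [j]: only the other
    vertices enter it. *)
Let H a (k : 'I_p.+1) x s (j : 'I_p.+2) : R :=
  (\sum_(l < p.+1) kuhn_mx a x s (lift ord0 k) (lift j l)) *
  cofactor (kuhn_mx a x s) (lift ord0 k) j.

(** Exchanging two consecutive steps of the path moves only the vertex between them, so the opposite
    facet is unchanged. *)
Lemma H_interior a k x s (i : 'I_p) :
  let j := lift ord0 (widen_ord (leqnSn p) i) in
  H a k x (s * tperm (widen_ord (leqnSn p) i) (lift ord0 i))%g j = H a k x s j.
Proof.
move=> j.
have vE l : kuhn_vertex x (s * tperm (widen_ord (leqnSn p) i) (lift ord0 i))%g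
    (lift j l) = kuhn_vertex x s (lift j l).
  have jl : (lift j l : nat) != i.+1.
    by have := neq_lift j l; rewrite eq_sym -val_eqE /= /bump add1n.
  apply/ffunP => m; rewrite !ffunE permM; congr (_ + _)%N.
  case: tpermP => [->|->|//]; congr nat_of_bool; move: jl => /=;
    rewrite /bump !add1n => jl; lia.
rewrite /H; congr (_ * _).
  by apply: eq_bigr => l _; rewrite !mxE vE.
rewrite /cofactor; congr (_ * determinant _); apply/matrixP => r c.
by rewrite !mxE vE.
Qed.

Let ltn_ordF (l : 'I_p.+1) : (p < l)%N = false.
Proof. by rewrite ltnNge -ltnS ltn_ord. Qed.

Let c : 'S_p.+1 := lift_perm ord_max ord0 1.

(** The path of [s * c] first increments the coordinate that [s] increments last, then follows the
    path of [s] from the incremented base point, short of its last vertex. The two simplices share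
    this facet; the sign comes from the position of the deleted column. *)
Lemma H_rotate a k x s :
  H a k x (s * c)%g ord0 =
  (-1) ^+ p.+1 * H a k (incr_vertex x (s^-1 ord_max)%g) s ord_max.
Proof.
have vE (l : 'I_p.+1) : kuhn_vertex x (s * c)%g (lift ord0 l) =
    kuhn_vertex (incr_vertex x (s^-1 ord_max)%g) s (lift ord_max l).
  apply/ffunP => i; rewrite !ffunE permM lift_max -addnA; congr (_ + _)%N.
  have -> : (i == (s^-1)%g ord_max) = (s i == ord_max).
    by rewrite [RHS](can2_eq (permK s) (permKV s)).
  case: (unliftP ord_max (s i)) => [m ->|->].
    by rewrite lift_perm_lift perm1 eq_sym (negPf (neq_lift _ _)) lift_max.
  by rewrite lift_perm_id eqxx /= ltn_ordF.
rewrite /H [RHS]mulrCA; congr (_ * _).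
  by apply: eq_bigr => l _; rewrite !mxE vE.
rewrite /cofactor mulrA; congr (_ * _); last first.
  by congr determinant; apply/matrixP => r l; rewrite !mxE vE.
rewrite -exprD /= addn0 addnCA addnn -signr_odd -[RHS]signr_odd.
by rewrite oddD odd_double addbF.
Qed.

Definition const_on_faces (g : vertex -> R) (i : 'I_p.+1) :=
  forall e, e = 0%N \/ e = N -> exists d, forall y : vertex, y i = e -> g y = d.

(** All vertices of this facet lie in one face of the grid. If its direction is [k], row [k]
    vanishes there; otherwise another row is a multiple of the row of ones, which kills the
    cofactor. *)
Lemma H_boundary a k (y : vertex) (s : 'S_p.+1) :
  (forall y, a ord0 y = 1) ->
  (forall y : vertex, y k = 0%N \/ y k = N -> a (lift ord0 k) y = 0) ->
  (forall i, i != k -> const_on_faces (a (lift ord0 i)) i) ->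
  y (s^-1 ord_max)%g = 0%N \/ y (s^-1 ord_max)%g = N ->
  H a k y s ord_max = 0.
Proof.
move=> a0 ak ai; set i0 := (s^-1)%g _ => yi0.
have vi0 (l : 'I_p.+1) : kuhn_vertex y s (lift ord_max l) i0 = y i0.
  by rewrite ffunE permKV lift_max /= ltn_ordF addn0.
rewrite /H; have [i0k|i0k] := eqVneq i0 k.
  by rewrite big1 ?mul0r// => l _; rewrite mxE ak// -i0k vi0.
have [d dP] := ai _ i0k _ yi0.
rewrite /cofactor.
have [r1 r1E _] : {j | lift ord0 i0 = lift (lift ord0 k) j &
    unlift (lift ord0 k) (lift ord0 i0) = Some j}.
  by apply: unlift_some; rewrite (inj_eq lift_inj) eq_sym.
have r0E : lift (lift ord0 k) ord0 = ord0 :> 'I_p.+2 by exact: val_inj.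
rewrite (@det_proportional_rows _ _ r1 ord0 d) ?mulr0//.
  by apply: contraTneq isT => r10; move: r1E; rewrite r10 r0E.
by move=> l; rewrite !mxE -r1E r0E a0 mulr1 dP// vi0.
Qed.

(* Summing the facet expansion, the interior facets of each cube cancel in pairs
   by [H_interior], and those shared by neighbouring cubes by [H_rotate]. *)
Lemma kuhn_sum_eq0 a k :
  (forall y, a ord0 y = 1) ->
  (forall y : vertex, y k = 0%N \/ y k = N -> a (lift ord0 k) y = 0) ->
  (forall i, i != k -> const_on_faces (a (lift ord0 i)) i) ->
  kuhn_sum a = 0.
Proof.
move=> a0 ak ai.
have -> : kuhn_sum a = - \sum_(x : {ffun 'I_p.+1 -> 'I_N})
    \sum_(s : 'S_p.+1) \sum_(j < p.+2) (-1) ^+ s * H a k (grid_vertex x) s j.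
  rewrite -sumrN; apply: eq_bigr => x _; rewrite -sumrN; apply: eq_bigr => s _.
  rewrite (@det_facet_expansion _ _ (lift ord0 k))//; last first.
    by move=> j; rewrite mxE a0.
  by rewrite mulrN mulr_sumr.
apply/eqP; rewrite oppr_eq0; apply/eqP.
pose E x j : R := \sum_(s : 'S_p.+1) (-1) ^+ s * H a k (grid_vertex x) s j.
transitivity (\sum_x (E x ord0 + E x ord_max)).
  apply: eq_bigr => x _; rewrite exchange_big big_ord_recl big_ord_recr /=.
  rewrite [X in _ + (X + _)]big1 ?add0r => [|i _].
    by congr (_ + E x _); exact: val_inj.
  set j := lift _ _; set X := \sum_s _.
  have XN : X = - X.
    rewrite {1}/X (reindex_inj (mulIg
      (tperm (widen_ord (leqnSn p) i) (lift ord0 i)))).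
    rewrite -sumrN; apply: eq_bigr => s _.
    rewrite H_interior odd_permM odd_tperm signr_addb.
    have -> : widen_ord (leqnSn p) i != lift ord0 i.
      by rewrite -val_eqE /= /bump add1n neq_ltn ltnSn.
    by rewrite expr1 mulrN1 mulNr.
  by apply/eqP; move/eqP: XN; rewrite -subr_eq0 opprK -mulr2n mulrn_eq0.
have E0 x : E x ord0 = - \sum_(s : 'S_p.+1)
    (-1) ^+ s * H a k (incr_vertex (grid_vertex x) (s^-1 ord_max)%g) s ord_max.
  rewrite /E (reindex_inj (mulIg c)) -sumrN; apply: eq_bigr => s _.
  (* [c] is a cycle of length [p.+1]; against the sign in [H_rotate] a single minus remains. *)
  have cE : (-1) ^+ c = (-1) ^+ p :> R.
    by rewrite odd_lift_perm odd_perm1 !addbF signr_odd.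
  rewrite H_rotate odd_permM signr_addb cE exprS.
  have signE (u e h : R) : e ^+ 2 = 1 -> u * e * (-1 * e * h) = - (u * h).
    by move=> e1; rewrite mulN1r !mulNr mulrN mulrA -(mulrA u) -expr2 e1 mulr1.
  by apply: signE; rewrite sqrr_sign.
rewrite (eq_bigr _ (fun x _ => congr1 (+%R^~ _) (E0 x))) big_split /= sumrN.
rewrite addrC; apply/eqP; rewrite subr_eq0; apply/eqP.
rewrite exchange_big [RHS]exchange_big /=; apply: eq_bigr => s _.
rewrite -!mulr_sumr; congr (_ * _); apply/esym.
apply: (@sum_incr_vertex (fun y => H a k y s ord_max)) => y.
exact: H_boundary.
Qed.

(** Homogeneous coordinates of the identity map. *)
Let std (r : 'I_p.+2) (y : vertex) : R :=
  if unlift ord0 r is Some i then (y i)%:R else 1.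

Lemma det_kuhn_std x s : \det (kuhn_mx std x s) = (-1) ^+ s.
Proof.
pose T1 : 'rV[R]_p.+2 := const_mx 1.
pose T2 : 'M[R]_(p.+1, p.+2) := \matrix_(i, j) (i < j)%N%:R.
pose T : 'M[R]_p.+2 := col_mx T1 T2.
pose X : 'cV[R]_p.+1 := \col_i (x i)%:R.
have TE i j : T i j = (i <= j)%N%:R.
  rewrite /T mxE; case: splitP => i' iE; rewrite !mxE iE ?add1n//.
  by rewrite (ord1 i') leq0n.
have -> : kuhn_mx std x s = block_mx 1%:M 0 X (perm_mx s) *m T.
  rewrite mul_block_col mul1mx mul0mx addr0; apply/matrixP => r j.
  rewrite !mxE; case: splitP => i ri.
    have -> : r = ord0 by apply: val_inj; rewrite /= ri (ord1 i).
    by rewrite /std unlift_none mxE.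
  have -> : r = lift ord0 i by apply: val_inj; rewrite /= ri /bump add1n.
  rewrite /std liftK -row_permE !mxE big_ord1 !mxE mulr1 !ffunE natrD.
  by [].
rewrite det_mulmx (_ : \det _ = (-1) ^+ s); last first.
  by rewrite (@det_lblock _ 1 p.+1) det1 mul1r det_perm.
rewrite -[\det T]det_tr det_trig.
  by rewrite big1 ?mulr1// => i _; rewrite mxE TE leqnn.
apply/is_trig_mxP => i j ij; rewrite mxE TE leqNgt.
by rewrite ij.
Qed.

Lemma kuhn_sum_std : (0 < N)%N -> kuhn_sum std != 0.
Proof.
move=> N0.
have -> : kuhn_sum std = (#|{ffun 'I_p.+1 -> 'I_N}| * #|{: 'S_p.+1}|)%:R.
  rewrite /kuhn_sum (eq_bigr (fun _ => #|{: 'S_p.+1}|%:R)).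
    by rewrite sumr_const natrM mulr_natl.
  move=> x _; rewrite (eq_bigr (fun=> 1)) ?sumr_const// => s _.
  by rewrite det_kuhn_std -signr_addb addbb.
rewrite pnatr_eq0 -lt0n muln_gt0 card_ffun !card_ord expn_gt0 N0 /=.
by apply/card_gt0P; exists 1%g.
Qed.

(** The rows of [a] are replaced by those of the identity one at a time. By multilinearity each
    replacement changes the sum by one whose row [k] vanishes on the faces of direction [k], hence
    by 0. *)
Lemma kuhn_sum_boundary (a : 'I_p.+2 -> vertex -> R) :
  (forall y, a ord0 y = 1) ->
  (forall i (y : vertex), y i = 0%N -> a (lift ord0 i) y = 0) ->
  (forall i (y : vertex), y i = N -> a (lift ord0 i) y = N%:R) ->
  kuhn_sum a = kuhn_sum std.
Proof.
move=> a1 a0 aN.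
pose hyb t (r : 'I_p.+2) y := if (r <= t)%N then std r y else a r y.
have stdf i (y : vertex) : std (lift ord0 i) y = (y i)%:R.
  by rewrite /std liftK.
have std0 y : std ord0 y = 1 by rewrite /std unlift_none.
have hybS (k : 'I_p.+1) : kuhn_sum (hyb k) = kuhn_sum (hyb k.+1).
  pose d r y := if r == lift ord0 k then a r y - std r y else hyb k r y.
  suff -> : kuhn_sum (hyb k) = kuhn_sum d + kuhn_sum (hyb k.+1).
    rewrite (@kuhn_sum_eq0 d k) ?add0r// => [y|i ik].
    - by rewrite /d eqxx stdf => -[] yk; rewrite ?(a0 _ _ yk) ?(aN _ _ yk) yk subrr.
    - rewrite /d (inj_eq lift_inj) (negPf ik) /hyb => e eE; exists e%:R => y ye.
      case: ifP => _; first by rewrite stdf ye.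
      by move: ye; case: eE => -> ye; rewrite ?(a0 _ _ ye) ?(aN _ _ ye).
  rewrite /kuhn_sum -big_split; apply: eq_bigr => x _ /=.
  rewrite -big_split; apply: eq_bigr => s _ /=; rewrite -mulrDr; congr (_ * _).
  rewrite (@determinant_multilinear _ _ _ (kuhn_mx d (grid_vertex x) s)
    (kuhn_mx (hyb k.+1) (grid_vertex x) s) (lift ord0 k) 1 1) ?mul1r//.
  - apply/rowP => j; rewrite !mxE !mul1r /d eqxx /hyb /= /bump /= add1n.
    by rewrite ltnn leqnn subrK.
  - apply/matrixP => r j; rewrite !mxE /d eq_sym (negPf (neq_lift _ _)).
    by [].
  - apply/matrixP => r j; rewrite !mxE /hyb.
    have := neq_lift (lift ord0 k) r; rewrite -val_eqE [val (lift ord0 k)]/=.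
    rewrite {1}/bump add1n => rk.
    by rewrite [in LHS]leq_eqVlt eq_sym (negPf rk) ltnS.
have hyb0 : kuhn_sum a = kuhn_sum (hyb 0%N).
  apply: eq_bigr => x _; apply: eq_bigr => s _; congr (_ * determinant _).
  apply/matrixP => r j; rewrite !mxE /hyb leqn0.
  case: eqVneq => // r0; have -> : r = ord0 by exact: val_inj.
  by rewrite std0 a1.
rewrite hyb0; have hybE t : (t <= p.+1)%N -> kuhn_sum (hyb 0%N) = kuhn_sum (hyb t).
  elim: t => // t IH tp; rewrite IH 1?ltnW//.
  exact: (hybS (Ordinal tp)).
rewrite (hybE p.+1)//.
apply: eq_bigr => x _; apply: eq_bigr => s _; congr (_ * determinant _).
by apply/matrixP => r j; rewrite !mxE /hyb -ltnS ltn_ord.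
Qed.

(** Discrete Poincare-Miranda. Labels encoded as the values 0 and [N] have the boundary values of
    the identity, so some determinant is nonzero; a label constant on that simplex would make its
    row proportional to the row of ones. *)
Lemma kuhn_cell (b : 'I_p.+1 -> vertex -> bool) :
  (0 < N)%N ->
  (forall i (y : vertex), y i = 0%N -> ~~ b i y) ->
  (forall i (y : vertex), y i = N -> b i y) ->
  exists x : {ffun 'I_p.+1 -> 'I_N}, forall i, exists v v' : vertex,
    [/\ forall m, (x m <= v m <= (x m).+1)%N,
        forall m, (x m <= v' m <= (x m).+1)%N, b i v & ~~ b i v'].
Proof.
move=> N0 b0 bN.
pose a (r : 'I_p.+2) y : R :=
  if unlift ord0 r is Some i then if b i y then N%:R else 0 else 1.
have Sa : kuhn_sum a != 0.
  rewrite kuhn_sum_boundary ?kuhn_sum_std//.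
  - by move=> y; rewrite /a unlift_none.
  - by move=> i y yi; rewrite /a liftK (negPf (b0 _ _ yi)).
  - by move=> i y yi; rewrite /a liftK (bN _ _ yi).
have [x [s dx]] : exists x s, \det (kuhn_mx a (grid_vertex x) s) != 0.
  apply: contrapT => h; move/eqP: Sa; apply.
  rewrite /kuhn_sum big1// => x _; rewrite big1// => s _.
  have [->|dn0] := eqVneq (\det (kuhn_mx a (grid_vertex x) s)) 0.
    by rewrite mulr0.
  by exfalso; apply: h; exists x, s.
exists x => i.
have vP (j : 'I_p.+2) m :
    (x m <= kuhn_vertex (grid_vertex x) s j m <= (x m).+1)%N.
  by rewrite !ffunE; case: (_ < _)%N; rewrite ?addn0 ?addn1 !leqnn ?leqnSn.
pose v j := kuhn_vertex (grid_vertex x) s j.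
have [/forallP bT|/forallPn[j' bj']] := boolP [forall j : 'I_p.+2, b i (v j)].
  exfalso; move/eqP: dx; apply.
  apply: (@det_proportional_rows _ _ (lift ord0 i) ord0 N%:R) => // j.
  by rewrite !mxE /a liftK unlift_none (bT j) mulr1.
have [/forallP bF|/forallPn[j bj]] := boolP [forall j : 'I_p.+2, ~~ b i (v j)].
  exfalso; move/eqP: dx; apply.
  apply: (@det_proportional_rows _ _ (lift ord0 i) ord0 0) => // j.
  by rewrite !mxE /a liftK unlift_none (negPf (bF j)) mul0r.
by exists (v j), (v j'); rewrite negbK in bj; split.
Qed.

End KuhnSum.

(** * Maps near the identity, and volume by counting grid points *)

Section NearIdentity.
Variable R : realType.

(** A displacement of at most [g] fixes the labels [y i <= f i] on the faces of the cube. Each label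
    changes within one grid cell, on which [f] varies by at most [t]; hence the approximate
    preimage. *)
Lemma near_identity_dense p (f : 'rV[R]_p.+1 -> 'rV[R]_p.+1) (K s g : R) :
  0 < s -> 0 < K ->
  (forall x y, `|x| <= s -> `|y| <= s -> `|f x - f y| <= K * `|x - y|) ->
  (forall x, `|x| <= s -> `|f x - x| <= g) ->
  forall y, `|y| < s - g -> forall t, 0 < t ->
  exists2 x, `|x| <= s & `|f x - y| <= t.
Proof.
move=> s0 K0 fK fg y ys t t0.
pose N := (Num.bound (K * (2 * s) / t)).+1.
have N0 : 0 < N%:R :> R by rewrite ltr0n.
have NE : K * (2 * s / N%:R) <= t.
  rewrite mulrA ler_pdivrMr// [t * _]mulrC -ler_pdivrMr//.
  apply: ltW; apply: lt_le_trans (archi_boundP _) _.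
    by rewrite divr_ge0 ?mulr_ge0// ltW.
  by rewrite ler_nat.
(* [minn] keeps every vertex inside the cube, also those beyond the grid. *)
pose P (v : {ffun 'I_p.+1 -> nat}) : 'rV[R]_p.+1 :=
  \row_i (2 * s / N%:R * (minn (v i) N)%:R - s).
have Ps v : `|P v| <= s.
  apply: norm_le_coord => [|i]; first exact: ltW.
  have mN : (minn (v i) N)%:R / N%:R <= 1 :> R.
    by rewrite ler_pdivrMr// mul1r ler_nat geq_minr.
  have m0 : 0 <= (minn (v i) N)%:R / N%:R :> R by rewrite divr_ge0.
  rewrite mxE mulrAC -mulrA ler_norml; nra.
have fP v i : `|f (P v) ord0 i - P v ord0 i| <= g.
  have := le_trans (coord_le_norm (f (P v) - P v) i) (fg _ (Ps v)).
  by rewrite !mxE.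
have yi i : `|y ord0 i| < s - g := le_lt_trans (coord_le_norm y i) ys.
have [|i v vi|i v vi|x xP] := @kuhn_cell R p N
    (fun i v => y ord0 i <= f (P v) ord0 i) => //.
- rewrite -ltNge; have := fP v i; have := yi i.
  rewrite [P v ord0 i]mxE vi min0n mulr0 sub0r ltr_norml ler_norml.
  by move=> /andP[? ?] /andP[? ?]; lra.
- have := fP v i; have := yi i.
  rewrite [P v ord0 i]mxE vi minnn divfK ?gt_eqF// ltr_norml ler_norml.
  by move=> /andP[? ?] /andP[? ?]; lra.
pose X := P [ffun i => x i : nat].
have Xv (v : {ffun 'I_p.+1 -> nat}) i : (forall m, (x m <= v m <= (x m).+1)%N) ->
    `|f X ord0 i - f (P v) ord0 i| <= t.
  move=> xv; apply: le_trans NE.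
  have := coord_le_norm (f X - f (P v)) i; rewrite !mxE => /le_trans; apply.
  apply: le_trans (fK _ _ (Ps _) (Ps _)) _.
  rewrite ler_pM2l//; apply: norm_le_coord => [|m].
    by rewrite divr_ge0// mulr_ge0// ltW.
  rewrite !mxE ffunE opprB addrA subrK -mulrBr normrM ger0_norm; last first.
    by rewrite divr_ge0// mulr_ge0// ltW.
  rewrite ler_piMr ?divr_ge0 ?mulr_ge0 ?(ltW s0)//.
  have xN : (x m < N)%N := ltn_ord (x m).
  rewrite (minn_idPl (ltnW xN)).
  have := xv m => /andP[]; case: ltngtP => // [xm _|<- _].
    move=> vx; have -> : v m = (x m).+1 by apply/eqP; rewrite eqn_leq xm vx.
    by rewrite (minn_idPl xN) -natr1 opprD addrA subrr sub0r normrN1.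
  by rewrite (minn_idPl (ltnW xN)) subrr normr0.
exists X; first exact: Ps.
apply: norm_le_coord => [|i]; first exact: ltW.
have [v [v' [vx vx' /= bv]]] := xP i; rewrite -ltNge => bv'.
have := Xv v i vx; have := Xv v' i vx'; rewrite !mxE !ler_norml.
move=> /andP[? ?] /andP[? ?]; lra.
Qed.

Lemma card_ord_window L (T : {set 'I_L}) c :
  (forall a b : 'I_L, a \in T -> b \in T -> (b < a + c)%N) -> (#|T| <= c)%N.
Proof.
move=> Tc; have [->|[a0 a0T]] := set_0Vmem T; first by rewrite cards0.
case: (@arg_minnP _ a0 (mem T) val a0T) => a aT amin.
rewrite cardE -(size_map val) -(size_iota a c).
apply: uniq_leq_size; first by rewrite (map_inj_uniq val_inj) enum_uniq.
move=> _ /mapP[b + ->]; rewrite mem_enum mem_iota => bT.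
by rewrite amin//= Tc.
Qed.

Lemma seq_pos_lower_bound (D : seq nat) (rho : nat -> R) :
  (forall i, i \in D -> 0 < rho i) ->
  exists2 t, 0 < t & forall i, i \in D -> t <= rho i.
Proof.
elim: D => [_|i D IH rho0]; first by exists 1.
have [j jD|t t0 tD] := IH; first by rewrite rho0// inE jD orbT.
exists (Num.min t (rho i)); first by rewrite lt_min t0 rho0// mem_head.
move=> j; rewrite inE => /orP[/eqP->|/tD jt]; rewrite ge_min ?lexx ?orbT//.
by rewrite jt.
Qed.

(** Volumes are replaced by numbers of points of a grid with [G] points per axis. Once
    [rho i * G / s >= 1], an interval of length [2 * rho i] has at most
    [rho i * G / s + 1 <= 2 * rho i * G / s] of them; this costs a factor 2 per axis. *)
Lemma ball_cover_volume p (D : seq nat) (c : nat -> 'rV[R]_p.+1)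
    (rho : nat -> R) (s : R) :
  0 < s -> (forall i, i \in D -> 0 < rho i) ->
  (forall y, `|y| <= s -> exists2 i, i \in D & `|y - c i| <= rho i) ->
  s ^+ p.+1 <= \sum_(i <- D) (2 * rho i) ^+ p.+1.
Proof.
move=> s0 rho0 cov.
have [t t0 tD] := seq_pos_lower_bound rho0.
pose G := (Num.bound (s / t)).+1.
have G0 : 0 < G%:R :> R by rewrite ltr0n.
have Gt : s / t <= G%:R.
  apply: ltW; apply: lt_le_trans (archi_boundP _) _.
    by rewrite divr_ge0// ltW.
  by rewrite ler_nat.
pose P (z : {ffun 'I_p.+1 -> 'I_G}) : 'rV[R]_p.+1 :=
  \row_i (2 * s / G%:R * (z i)%:R - s).
have Ps z : `|P z| <= s.
  apply: norm_le_coord => [|i]; first exact: ltW.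
  have mN : (z i)%:R / G%:R <= 1 :> R.
    by rewrite ler_pdivrMr// mul1r ler_nat ltnW.
  have m0 : 0 <= (z i)%:R / G%:R :> R by rewrite divr_ge0.
  rewrite mxE mulrAC -mulrA ler_norml; nra.
have cnt i : i \in D -> \sum_z (`|P z - c i| <= rho i)%R%:R <=
    (2 * rho i * G%:R / s) ^+ p.+1.
  move=> iD.
  pose T j : {set 'I_G} := finset (fun a : 'I_G =>
    `|2 * s / G%:R * a%:R - s - c i ord0 j| <= rho i).
  apply: (@le_trans _ _ (\prod_(j < p.+1) \sum_(a < G) (a \in T j)%:R)).
    rewrite bigA_distr_bigA /=; apply: ler_sum => z _.
    case: (boolP (`|P z - c i| <= rho i)) => [zi|_]; last first.
      by rewrite prodr_ge0.
    rewrite big1// => j _; rewrite inE.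
    have := le_trans (coord_le_norm (P z - c i) j) zi.
    by rewrite !mxE => ->.
  rewrite -[p.+1 in leRHS]card_ord -prodr_const; apply: ler_prod => j _.
  rewrite sumr_ge0//=.
  have -> : \sum_(a < G) (a \in T j)%:R = #|T j|%:R :> R.
    by rewrite -natr_sum -sum1_card [in RHS]big_mkcond.
  have rG : 1 <= rho i * G%:R / s.
    rewrite ler_pdivlMr// mul1r; apply: (@le_trans _ _ (t * G%:R)).
      by rewrite mulrC -ler_pdivrMr.
    by rewrite ler_pM2r// tD.
  have r0 : 0 <= rho i * G%:R / s by apply: le_trans rG.
  have /andP[tr1 tr2] := truncn_itv r0.
  apply: (@le_trans _ _ (Num.truncn (rho i * G%:R / s)).+1%:R); last first.
    rewrite -natr1 (_ : 2 * rho i * G%:R / s = rho i * G%:R / s + rho i * G%:R / s).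
      by rewrite lerD.
    by ring.
  rewrite ler_nat; apply: card_ord_window => a b.
  rewrite !inE !ler_norml => /andP[a1 _] /andP[_ b1].
  rewrite ltnNge; apply/negP => ba.
  move: tr2; apply/negP; rewrite -leNgt.
  have ab : (a <= b)%N by lia.
  apply: (@le_trans _ _ (b - a)%:R); first by rewrite ler_nat; lia.
  have G2 : 0 < 2 / G%:R :> R by rewrite divr_gt0.
  rewrite natrB// ler_pdivlMr// -(ler_pM2r G2).
  have -> : rho i * G%:R * (2 / G%:R) = 2 * rho i.
    by field; rewrite gt_eqF.
  have -> : (b%:R - a%:R) * s * (2 / G%:R) =
    2 * s / G%:R * b%:R - 2 * s / G%:R * a%:R by ring.
  lra.
have GD : G%:R ^+ p.+1 <= \sum_(i <- D) (2 * rho i * G%:R / s) ^+ p.+1.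
  apply: (@le_trans _ _ (\sum_(z : {ffun 'I_p.+1 -> 'I_G})
      \sum_(i <- D) (`|P z - c i| <= rho i)%R%:R)).
    rewrite -natrX -[p.+1 in leLHS]card_ord -[G in leLHS]card_ord -card_ffun.
    rewrite -sum1_card natr_sum; apply: ler_sum => z _.
    have [i iD zi] := cov _ (Ps z).
    rewrite (big_rem i)//= zi lerDl; apply: sumr_ge0 => k _.
    by rewrite ler0n.
  by rewrite exchange_big /= big_seq [leRHS]big_seq; apply: ler_sum => i; exact: cnt.
rewrite -(ler_pM2r (_ : 0 < (G%:R / s) ^+ p.+1)) ?exprn_gt0 ?divr_gt0//.
rewrite -exprMn [s * _]mulrC divfK ?gt_eqF// (le_trans GD)// mulr_suml.
by apply: ler_sum => i _; rewrite -exprMn mulrA.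
Qed.

End NearIdentity.

(** * Retraction onto the cube, Euclidean distance, diameters *)

Section Geometry.
Variable R : realType.

(** Composing with this retraction turns a map that is Lipschitz on the cube into one that is
    Lipschitz everywhere. *)
Definition clamp k (x : 'rV[R]_k) : 'rV[R]_k :=
  \row_i Num.max (-1) (Num.min 1 (x ord0 i)).

Lemma clamp_norm_le k (x : 'rV[R]_k) : `|clamp x| <= 1.
Proof.
apply: norm_le_coord => // i; rewrite mxE ler_norml le_max lexx /=.
by rewrite ge_max ge_min lexx /= andbT; lra.
Qed.

Lemma clamp_id k (x : 'rV[R]_k) : `|x| <= 1 -> clamp x = x.
Proof.
move=> /cubeE cx; apply/rowP => i; rewrite mxE.
have /andP[? ?] := cx i.
by rewrite min_r// max_r.
Qed.

Lemma clamp_lipschitz k (x y : 'rV[R]_k) : `|clamp x - clamp y| <= `|x - y|.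
Proof.
apply: norm_le_coord => // i; rewrite !mxE.
have := coord_le_norm (x - y) i; rewrite !mxE; apply: le_trans.
rewrite /Num.max /Num.min; set a := x _ _; set b := y _ _.
rewrite ler_norml; have := ler_norm (a - b); have := ler_norm (b - a).
rewrite (distrC b a) => h1 h2.
by case: (ltP 1 a) => ?; case: (ltP 1 b) => ?; do 2?[case: ltP => ?];
  apply/andP; lra.
Qed.

Lemma lipschitz_open k l (g : 'rV[R]_k -> 'rV[R]_l) (K : R) e (rho : R) :
  0 < K -> (forall x y, `|g x - g y| <= K * `|x - y|) ->
  open [set x | `|g x - e| < rho].
Proof.
move=> K0 gK; rewrite openE => x /= xr; apply/nbhs_ballP.
exists ((rho - `|g x - e|) / K) => /=; first by rewrite divr_gt0// subr_gt0.
move=> y; rewrite -ball_normE /= ltr_pdivlMr// => xy.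
rewrite (le_lt_trans (ler_distD (g x) _ _))// -ltrBrDr (le_lt_trans _ xy)//.
by rewrite distrC mulrC.
Qed.

Lemma norm_le_eucl k (x y : 'rV[R]_k) : `|x - y| <= eucl_dist x y.
Proof.
apply: norm_le_coord; first exact: sqrtr_ge0.
move=> i; rewrite !mxE -sqrtr_sqr ler_wsqrtr// (bigD1 i)//= lerDl.
by rewrite sumr_ge0// => j _; rewrite sqr_ge0.
Qed.

Lemma eucl_le_norm k (x y : 'rV[R]_k) : eucl_dist x y <= k%:R * `|x - y|.
Proof.
rewrite -[leRHS]ger0_norm ?mulr_ge0// -sqrtr_sqr ler_wsqrtr//.
apply: (@le_trans _ _ (\sum_(i < k) `|x - y| ^+ 2)).
  apply: ler_sum => i _; rewrite -real_normK ?num_real//.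
  by rewrite lerXn2r ?nnegrE//; have := coord_le_norm (x - y) i; rewrite !mxE.
rewrite sumr_const card_ord -[leLHS]mulr_natl exprMn ler_wpM2r ?sqr_ge0//.
by rewrite -natrX ler_nat; rewrite -mulnn; case: (k) => // k'; rewrite leq_pmulr.
Qed.

Lemma eucl_le_diam k (E : set 'rV[R]_k) x y :
  E x -> E y -> ((eucl_dist x y)%:E <= diam E)%E.
Proof.
move=> Ex Ey; rewrite /diam le_max; apply/orP; right.
by apply: ereal_sup_ubound; exists x => //; exists y.
Qed.

Lemma diam_ge0 k (E : set 'rV[R]_k) : (0 <= diam E)%E.
Proof. by rewrite /diam le_max lexx. Qed.

Lemma diam_le k (E : set 'rV[R]_k) (d : R) : 0 <= d ->
  (forall x y, E x -> E y -> eucl_dist x y <= d) -> (diam E <= d%:E)%E.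
Proof.
move=> d0 Ed; rewrite /diam ge_max lee_fin d0 /=.
by apply: ge_ereal_sup => _ [x Ex [y Ey <-]]; rewrite lee_fin Ed.
Qed.

Lemma diam_pow_ge0 k s (E : set 'rV[R]_k) : (0 <= diam_pow s E)%E.
Proof.
rewrite /diam_pow; case: ifP => // _.
by rewrite lee_fin exprn_ge0// fine_ge0// diam_ge0.
Qed.

End Geometry.

(** * Images of positive measure *)

Section LowerBound.
Variable R : realType.

Lemma cube_compact k : compact (@cube R k).
Proof.
have -> : @cube R k = [set v | forall i, `[(-1 : R), 1]%classic (v ord0 i)].
  by apply/seteqP; split=> v /= cv i; have := cv i; rewrite in_itv.
by apply: (@rV_compact _ k (fun=> `[(-1 : R), 1]%classic)) => i; exact: segment_compact.
Qed.

Definition nondegenerate n m (f : 'rV[R]_n -> 'rV[R]_m) :=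
  exists (P : 'M[R]_(m, n)) (y0 : 'rV[R]_n) (s g : R),
    [/\ 0 < s, s <= 1, g < s &
        forall x, `|x| <= s -> `|f x *m P - y0 - x| <= g].

Lemma half_powers_sum (c : R) M : 0 <= c -> \sum_(i <- iota 0 M) c / 2 ^+ i.+1 <= c.
Proof.
move=> c0; suff -> : \sum_(i <- iota 0 M) c / 2 ^+ i.+1 = c - c / 2 ^+ M.
  by rewrite gerBl divr_ge0// exprn_ge0.
elim: M => [|M IH]; first by rewrite big_nil expr0 divr1 subrr.
rewrite -[M.+1]addn1 iotaD big_cat IH big_seq1 add0n addn1 /= exprS.
by field; rewrite expf_eq0 andbC pnatr_eq0.
Qed.

Lemma exprD_le n (a b : R) : 0 <= a -> 0 <= b ->
  (a + b) ^+ n <= 2 ^+ n * (a ^+ n + b ^+ n).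
Proof.
wlog ab : a b / a <= b.
  move=> h a0 b0; have [ab|/ltW ba] := leP a b; first exact: h.
  by rewrite [a + b]addrC [_ ^+ n + _]addrC h.
move=> a0 b0; apply: (@le_trans _ _ ((2 * b) ^+ n)).
  by rewrite lerXn2r ?nnegrE ?addr_ge0 ?mulr_ge0// mulr_natl mulr2n lerD.
by rewrite exprMn ler_wpM2l ?exprn_ge0// lerDr exprn_ge0.
Qed.

Lemma hausdorff_gt0 p m (f : 'rV[R]_p.+1 -> 'rV[R]_m) (K : R) :
  0 < K -> (forall x y, `|x| <= 1 -> `|y| <= 1 -> `|f x - f y| <= K * `|x - y|) ->
  nondegenerate f ->
  (0 < hausdorff p.+1 (f @` @cube R p.+1))%E.
Proof.
move=> K0 fK [P [y0 [s [g [s0 s1 gs fP]]]]].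
have [C C0 PC] := norm_mulmx_le P.
pose s' := (s - g) / 2; have s'0 : 0 < s' by rewrite divr_gt0// subr_gt0.
(* [B] collects [C] from [P] and three factors 2, from the approximate preimages,
   [ball_cover_volume] and [exprD_le]. A premeasure below [c0] and enlargements of sum at most [c0]
   then give less than [s' ^+ p.+1 / 2]. *)
pose B := (8 * C) ^+ p.+1; have B0 : 0 < B by rewrite exprn_gt0// mulr_gt0.
pose c0 := Num.min 1 (s' ^+ p.+1 / (4 * B)).
have c00 : 0 < c0 by rewrite lt_min ltr01 /= divr_gt0 // ?exprn_gt0 // mulr_gt0.
have c01 : c0 <= 1 by rewrite ge_min lexx.
have Bc0 : B * c0 <= s' ^+ p.+1 / 4.
  apply: (@le_trans _ _ (B * (s' ^+ p.+1 / (4 * B)))).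
    by rewrite ler_pM2l// ge_min lexx orbT.
  by rewrite le_eqVlt; apply/orP; left; apply/eqP; field; rewrite gt_eqF.
apply: (@lt_le_trans _ _ (hausdorff_pre p.+1 1 (f @` @cube R p.+1))); last first.
  by apply: ereal_sup_ubound; exists 1 => //=.
apply: (@lt_le_trans _ _ c0%:E); first by rewrite lte_fin.
apply: le_ereal_inf_tmp => _ [E [fE E1] <-].
rewrite leNgt; apply/negP => Ec0.
have Efin i : diam (E i) = (fine (diam (E i)))%:E.
  rewrite fineK// ge0_fin_numE ?diam_ge0//.
  by rewrite (le_lt_trans (E1 i))// ltry.
pose d i := fine (diam (E i)).
have d0 i : 0 <= d i by rewrite fine_ge0// diam_ge0.
(* Enlarging by [eps i] makes the cover open, for compactness; [eps i <= 1] lets [eps i] bound its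
   own power. *)
pose eps i : R := c0 / 2 ^+ i.+1.
have eps0 i : 0 < eps i by rewrite divr_gt0// exprn_gt0.
have eps1 i : eps i <= 1.
  rewrite ler_pdivrMr ?exprn_gt0// mul1r (le_trans c01)//.
  by rewrite exprn_ege1// ler1n.
pose rho i := d i + eps i.
have rho0 i : 0 < rho i by rewrite ltr_wpDl.
pose e i := xget 0 (E i).
pose V i := [set x | `|f (clamp x) - e i| < rho i].
have fcK x y : `|f (clamp x) - f (clamp y)| <= K * `|x - y|.
  rewrite (le_trans (fK _ _ (clamp_norm_le _) (clamp_norm_le _)))//.
  by rewrite ler_pM2l// clamp_lipschitz.
have := @cube_compact p.+1; rewrite compact_cover.
move=> /(_ nat [set i | E i !=set0] V) [|x cx|D' D'E cov].
- by move=> i _; exact: (@lipschitz_open _ _ _ (f \o @clamp R _) K (e i) (rho i) K0 fcK).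
- have [i _ Ei] := fE _ (ex_intro2 _ _ x cx erefl).
  exists i => /=; first by exists (f x).
  have ei : E i (e i) by apply: xgetPex; exists (f x).
  rewrite /V /= clamp_id; last exact/cubeE.
  rewrite ltr_pwDr// (le_trans (norm_le_eucl _ _))// -lee_fin /d -Efin.
  exact: eucl_le_diam.
pose M := (\max_(i <- enum_fset D') i).+1.
pose D := [seq i <- iota 0 M | i \in D'].
have inD i : i \in D' -> i \in D.
  move=> iD; rewrite mem_filter iD mem_iota add0n ltnS.
  by rewrite (big_rem i)//= leq_maxl.
(* An error below every radius only doubles the balls. *)
have [t t0 tD] : exists2 t, 0 < t & forall i, i \in D -> t <= C * rho i.
  by apply: (@seq_pos_lower_bound R D (fun i => C * rho i)) => i _; rewrite mulr_gt0.
have cov' y : `|y| <= s' ->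
    exists2 i, i \in D & `|y - (e i *m P - y0)| <= 2 * (C * rho i).
  move=> ys.
  have hK x x' : `|x| <= s -> `|x'| <= s ->
      `|(f x *m P - y0) - (f x' *m P - y0)| <= C * K * `|x - x'|.
    move=> xs xs'; rewrite opprB addrA subrK -mulmxBl (le_trans (PC _))//.
    by rewrite -mulrA ler_pM2l// fK// (le_trans _ s1).
  have ys' : `|y| < s - g by rewrite (le_lt_trans ys)// /s'; move: gs; lra.
  have [x xs xy] := near_identity_dense s0 (mulr_gt0 C0 K0) hK fP ys' t0.
  have [i iD' /= Vi] : cover [set` D'] V x.
    by apply: cov; apply/cubeE; rewrite (le_trans xs).
  exists i; first exact: inD.
  move: Vi; rewrite /V /= clamp_id ?(le_trans xs)// => Vi.
  rewrite (le_trans (ler_distD (f x *m P - y0) _ _))// distrC.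
  have := tD _ (inD _ iD').
  have : `|f x *m P - y0 - (e i *m P - y0)| <= C * rho i.
    rewrite opprB addrA subrK -mulmxBl (le_trans (PC _))// ler_pM2l//.
    exact: ltW.
  by move: xy; lra.
pose dp i := fine (diam_pow p.+1 (E i)).
have dpE i : diam_pow p.+1 (E i) = (dp i)%:E.
  by rewrite /dp /diam_pow; case: ifP.
have dp0 i : 0 <= dp i by rewrite -lee_fin -dpE diam_pow_ge0.
have dps : \sum_(i <- iota 0 M) dp i < c0.
  rewrite -lte_fin (le_lt_trans _ Ec0)// -sumEFin.
  rewrite -(eq_bigr _ (fun i _ => dpE i)).
  have := @nneseries_lim_ge R (fun i => diam_pow p.+1 (E i)) predT 0%N M
    (fun i _ _ => diam_pow_ge0 _ _).
  by rewrite /index_iota subn0.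
have epss : \sum_(i <- iota 0 M) eps i <= c0.
  by apply: half_powers_sum; exact: ltW.
have term i : i \in D' -> (2 * (2 * (C * rho i))) ^+ p.+1 <= B * (dp i + eps i).
  move=> iD'; have -> : 2 * (2 * (C * rho i)) = (4 * C) * rho i by ring.
  rewrite exprMn (_ : B = (4 * C) ^+ p.+1 * 2 ^+ p.+1); last first.
    by rewrite -exprMn /B; congr (_ ^+ _); ring.
  rewrite -mulrA ler_pM2l ?exprn_gt0 ?mulr_gt0//.
  rewrite (le_trans (exprD_le _ (d0 i) (ltW (eps0 i))))// ler_pM2l ?exprn_gt0//.
  have -> : dp i = d i ^+ p.+1.
    have := dpE i; rewrite /diam_pow; case: asboolP => [Ei0|_ [<-]//].
    by have := D'E _ iD'; rewrite inE /= Ei0 => -[].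
  rewrite lerD2l exprS ler_piMr ?(ltW (eps0 _))//.
  by rewrite exprn_ile1// ltW.
have := @ball_cover_volume R p D (fun i => e i *m P - y0)
  (fun i => 2 * (C * rho i)) s' s'0.
move=> /(_ _ cov'); have h i : i \in D -> 0 < 2 * (C * rho i).
  by rewrite !mulr_gt0.
move=> /(_ h); apply/negP; rewrite -ltNge {h}.
apply: (@le_lt_trans _ _ (\sum_(i <- iota 0 M) B * (dp i + eps i))).
  rewrite big_filter [leLHS]big_mkcond; apply: ler_sum => i _.
  by case: ifP => [/term//|_]; rewrite mulr_ge0 ?addr_ge0// ltW.
rewrite -mulr_sumr big_split /=.
apply: (@lt_le_trans _ _ (B * (c0 + c0))).
  by rewrite ltr_pM2l// ltr_leD.
have := exprn_gt0 p.+1 s'0; move: Bc0; rewrite mulrDr; lra.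
Qed.

End LowerBound.

(** [e * ln] has slope [e / b] at [b], as the last clause demands; rising from 0 to 1 takes a ratio
    [expR e^-1] between the radii, whence [rho]. *)
Lemma slow_cutoff (R : realType) (e r : R) : 0 < e -> 0 < r ->
  exists (rho : R) (t : R -> R), [/\ 0 < rho,
    forall b, 0 <= t b <= 1, forall b, b <= rho -> t b = 0,
    forall b, r <= b -> t b = 1 &
    forall a b, 0 <= a -> a <= b -> a * `|t b - t a| <= e * (b - a)].
Proof.
move=> e0 r0; pose rho := r * expR (- e^-1).
have rho0 : 0 < rho by rewrite mulr_gt0 ?expR_gt0.
exists rho, (fun b => Num.max 0 (Num.min 1 (e * ln (b / rho)))); split=> //.
- by move=> b; rewrite le_max lexx /= ge_max ler01 ge_min lexx.
- move=> b br; have : ln (b / rho) <= 0 by rewrite ln_le0// ler_pdivrMr// mul1r.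
  move=> l0; have el0 : e * ln (b / rho) <= 0 by rewrite mulr_ge0_le0// ltW.
  by rewrite min_r ?(le_trans el0)// max_l.
- move=> b rb; have b0 : 0 < b := lt_le_trans r0 rb.
  have h : e^-1 <= ln (b / rho).
    rewrite -(expRK e^-1) ler_ln ?posrE ?expR_gt0 ?divr_gt0//.
    by rewrite ler_pdivlMr// /rho mulrCA -expRD subrr expR0 mulr1.
  rewrite min_l ?max_r// -ler_pdivrMl// mulr1.
  by [].
- move=> a b a0 ab; have [->|an0] := eqVneq a 0.
    by rewrite mul0r subr0 mulr_ge0 ?(le_trans a0 ab)// ltW.
  have ap : 0 < a by rewrite lt_def an0.
  have bp : 0 < b by exact: lt_le_trans ab.
  have lnb : ln (b / rho) - ln (a / rho) <= b / a - 1.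
    rewrite -ln_div ?posrE ?divr_gt0//.
    have -> : b / rho / (a / rho) = 1 + (b / a - 1).
      by field; rewrite an0 gt_eqF.
    by apply: le_ln1Dx; rewrite ltrBrDl subrr divr_gt0.
  have lnab : ln (a / rho) <= ln (b / rho).
    by rewrite ler_ln ?posrE ?divr_gt0// ler_pM2r ?invr_gt0.
  set u := ln (a / rho); set v := ln (b / rho).
  have clampE : `|Num.max 0 (Num.min 1 (e * v)) - Num.max 0 (Num.min 1 (e * u))|
      <= e * (v - u).
    have uv : e * u <= e * v by rewrite ler_pM2l.
    rewrite mulrBr; move: (e * u) (e * v) uv => u' v' uv.
    have cE (w : R) : let c := Num.max 0 (Num.min 1 w) in
        [\/ w <= 0 /\ c = 0, 0 <= w <= 1 /\ c = w | 1 <= w /\ c = 1].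
      have [w1|/ltW w1] := leP 1 w; first by rewrite max_r//; apply: Or33.
      have [w0|w0] := leP 0 w; first by apply: Or32; rewrite w1.
      by apply: Or31; rewrite ltW.
    rewrite ler_norml.
    have [[? ->]|[/andP[? ?] ->]|[? ->]] := cE v';
    have [[? ->]|[/andP[? ?] ->]|[? ->]] := cE u'; apply/andP; lra.
  apply: (@le_trans _ _ (a * (e * (v - u)))); first by rewrite ler_pM2l.
  apply: (@le_trans _ _ (a * (e * (b / a - 1)))).
    by rewrite ler_pM2l// ler_pM2l.
  rewrite le_eqVlt; apply/orP; left; apply/eqP; field.
  by [].
Qed.

(** * Openness and density of nondegenerate maps *)

Section Nondegenerate.
Variables (R : realType) (n m : nat).
Variables (Na : 'rV[R]_n -> R) (Nb : 'rV[R]_m -> R).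
Hypotheses (hNa : is_norm Na) (hNb : is_norm Nb).
Local Notation L := (Lip1 Na Nb).
Local Notation d := (@supdist R n m Nb).

Lemma Lip1_norm : exists2 K : R, 0 < K & forall f, L f ->
  forall x y, `|x| <= 1 -> `|y| <= 1 -> `|f x - f y| <= K * `|x - y|.
Proof.
have [C C0 NC] := is_norm_le hNa; have [c c0 Nc] := is_norm_ge hNb.
exists (C / c) => [|f [_ fL] x y /cubeE cx /cubeE cy]; first by rewrite divr_gt0.
rewrite mulrAC ler_pdivlMr// mulrC (le_trans (Nc _))//.
by rewrite (le_trans (fL _ _ cx cy)).
Qed.

Lemma cube0 : @cube R n 0.
Proof. by apply/cubeE; rewrite normr0. Qed.

Lemma supdist_ub f g x : L f -> L g -> cube x -> Nb (f x - g x) <= d f g.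
Proof.
move=> [[M fM] _] [[M' gM] _] cx; apply: ub_le_sup; last by exists x.
exists (M + M') => _ [y cy <-].
by rewrite (le_trans (is_normD hNb _ _))// is_normN// lerD ?fM ?gM.
Qed.

Lemma supdist_le f g c : (forall x, cube x -> Nb (f x - g x) <= c) -> d f g <= c.
Proof.
move=> fgc; apply: ge_sup; first by exists (Nb (f 0 - g 0)), 0 => //; exact: cube0.
by move=> _ [x cx <-]; exact: fgc.
Qed.

Lemma nondegenerate_open f : L f -> nondegenerate f ->
  exists2 r, 0 < r & forall g, L g -> d f g < r -> nondegenerate g.
Proof.
move=> Lf [P [y0 [s [e [s0 s1 es fP]]]]].
have [C C0 PC] := norm_mulmx_le P; have [c c0 Nc] := is_norm_ge hNb.
exists ((s - e) / 2 / C * c).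
  by rewrite mulr_gt0// divr_gt0// divr_gt0// subr_gt0.
move=> g Lg fg; exists P, y0, s, (e + (s - e) / 2).
split=> // [|x xs]; first by move: es; lra.
have cx : cube x by apply/cubeE; exact: le_trans xs s1.
have -> : g x *m P - y0 - x = (f x *m P - y0 - x) + (g x - f x) *m P.
  rewrite mulmxBl; move: (f x *m P) (g x *m P) => u v.
  by apply/rowP => i; rewrite !mxE; ring.
rewrite (le_trans (ler_normD _ _))// lerD ?fP// (le_trans (PC _))//.
rewrite mulrC -ler_pdivlMr// -(ler_pM2l c0) (le_trans (Nc _))//.
rewrite is_norm_distC// [leRHS]mulrC (le_trans (supdist_ub Lf Lg cx))//.
exact: ltW.
Qed.

Lemma nondegenerate_dense f (r : R) : (n <= m)%N -> L f -> 0 < r ->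
  exists g, [/\ L g, nondegenerate g & d f g < r].
Proof.
move=> nm Lf r0; have [[M0 fM0] fL] := Lf.
have [Ca Ca0 NaC] := is_norm_le hNa; have [ca ca0 cNa] := is_norm_ge hNa.
have [Cb Cb0 NbC] := is_norm_le hNb.
pose B : 'M[R]_(n, m) := pid_mx n.
have [CB CB0 BC] := norm_mulmx_le B.
pose D := Cb * CB / ca; have D0 : 0 < D by rewrite divr_gt0// mulr_gt0.
have BD x : Nb (x *m B) <= D * Na x.
  rewrite (le_trans (NbC _))// /D -!mulrA ler_pM2l//.
  rewrite (le_trans (BC _))// ler_pM2l// mulrC ler_pdivlMr// mulrC.
  exact: cNa.
pose M := `|M0|.
have M_ge0 : 0 <= M by rewrite normr_ge0.
have fM x : cube x -> Nb (f x) <= M.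
  by move=> /fM0 h; rewrite (le_trans h)// ler_norm.
pose A := 3 * (M + Ca + 1).
have A0 : 0 < A by rewrite mulr_gt0// ltr_wpDl// addr_ge0// ltW.
pose e := Num.min 2^-1 (r / A).
have e0 : 0 < e by rewrite lt_min invr_gt0 ltr0n divr_gt0.
have e1 : e <= 2^-1 by rewrite ge_min lexx.
have eA : e * (M + Ca) <= r / 3.
  have : e * A <= r by rewrite -ler_pdivlMr// ge_min lexx orbT.
  by rewrite /A; move: e0; lra.
have r3 : 0 < r / 3 by rewrite divr_gt0.
have [rho [t [rho0 t01 t0 t1 tL]]] := slow_cutoff e0 r3.
pose T x := t (Na x) *: x.
have Tcube x : cube x -> cube (T x).
  move=> /cubeE x1; apply/cubeE; rewrite normrZ.
  have /andP[t0x t1x] := t01 (Na x).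
  by rewrite ger0_norm// mulr_ile1.
have TL x y : Na (T x - T y) <= (1 + e) * Na (x - y).
  wlog xy : x y / Na x <= Na y.
    move=> h; have [|/ltW] := leP (Na x) (Na y); first exact: h.
    by move=> /h; rewrite is_norm_distC// [in leRHS]is_norm_distC.
  (* The difference of cutoffs multiplies [x], the shorter vector, as the last clause of
     [slow_cutoff] requires. *)
  have -> : T x - T y = t (Na y) *: (x - y) + (t (Na x) - t (Na y)) *: x.
    by apply/rowP => i; rewrite !mxE; ring.
  rewrite (le_trans (is_normD hNa _ _))// !is_normZ// mulrDl mul1r lerD//.
    have /andP[t0y t1y] := t01 (Na y).
    by rewrite ger0_norm// ler_piMl// is_norm_ge0.
  rewrite mulrC distrC (le_trans (tL _ _ (is_norm_ge0 hNa _) xy))//.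
  by rewrite ler_pM2l// is_norm_distC// is_norm_sub.
have Tx x : Na (T x - x) <= r / 3.
  have -> : T x - x = (t (Na x) - 1) *: x by rewrite scalerBl scale1r.
  rewrite is_normZ//; have [/t1 ->|/ltW xr] := leP (r / 3) (Na x).
    by rewrite subrr normr0 mul0r ltW.
  have /andP[t0x t1x] := t01 (Na x).
  rewrite (le_trans _ xr)// ler_piMl ?is_norm_ge0// ler_norml.
  by apply/andP; lra.
(* With this [k] the Lipschitz constants add up to [(1 - e) * (1 + e) + k * D = 1]. *)
pose k := e ^+ 2 / D; have k0 : 0 < k by rewrite divr_gt0// exprn_gt0.
have kD : k * D = e ^+ 2 by rewrite divfK// gt_eqF.
pose g x := (1 - e) *: f (T x) + k *: (x *m B).
have gL x y : cube x -> cube y -> Nb (g x - g y) <= Na (x - y).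
  move=> cx cy.
  have -> : g x - g y = (1 - e) *: (f (T x) - f (T y)) + k *: ((x - y) *m B).
    rewrite /g mulmxBl; move: (f (T x)) (f (T y)) (x *m B) (y *m B) => a b a' b'.
    by apply/rowP => i; rewrite !mxE; ring.
  rewrite (le_trans (is_normD hNb _ _))// !is_normZ// !ger0_norm; last 2 first.
  - by rewrite ltW.
  - by move: e1; lra.
  apply: (@le_trans _ _ ((1 - e) * ((1 + e) * Na (x - y)) + k * (D * Na (x - y)))).
    apply: lerD; last by rewrite ler_pM2l.
    rewrite ler_pM2l; last by move: e1; lra.
    by rewrite (le_trans (fL _ _ (Tcube _ cx) (Tcube _ cy))).
  rewrite mulrA [k * _]mulrA kD -mulrDl.
  have -> : (1 - e) * (1 + e) + e ^+ 2 = 1 by ring.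
  by rewrite mul1r.
have kB x : cube x -> Nb (k *: (x *m B)) <= e * Ca.
  move=> /cubeE x1; rewrite is_normZ// gtr0_norm//.
  apply: (@le_trans _ _ (k * (D * Ca))).
    rewrite ler_pM2l// (le_trans (BD _))// ler_pM2l// (le_trans (NaC _))//.
    by rewrite ler_piMr// ltW.
  by rewrite mulrA kD ler_pM2r// expr2 ler_piMl ?(ltW e0)//; move: e1; lra.
have Lg : L g.
  split=> //; exists (M + e * Ca) => x cx.
  rewrite (le_trans (is_normD hNb _ _))// lerD ?kB//.
  rewrite is_normZ// (le_trans _ (fM _ (Tcube _ cx)))// ler_piMl ?is_norm_ge0//.
  by rewrite ler_norml; apply/andP; move: e0 e1; lra.
exists g; split=> //; last first.
  apply: (@le_lt_trans _ _ (r / 3 + r / 3)); last by move: r0; lra.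
  apply: supdist_le => x cx.
  have -> : f x - g x = (f x - f (T x)) + (e *: f (T x) - k *: (x *m B)).
    rewrite /g; move: (f (T x)) (x *m B) => a a'.
    by apply/rowP => i; rewrite !mxE; ring.
  rewrite (le_trans (is_normD hNb _ _))// lerD//.
    by rewrite (le_trans (fL _ _ cx (Tcube _ cx)))// is_norm_distC.
  rewrite (le_trans (is_normD hNb _ _))// is_normN// (le_trans _ eA)//.
  rewrite mulrDr lerD ?kB// is_normZ// gtr0_norm// ler_pM2l//.
  by rewrite fM//; exact: Tcube.
(* Where [Na x <= rho], [T x = 0] and [g] is affine with linear part [k *: B], which this matrix
   inverts because [n <= m]; the deviation is exactly 0. *)
exists (k^-1 *: (pid_mx n : 'M[R]_(m, n))).
exists ((1 - e) *: f 0 *m (k^-1 *: (pid_mx n : 'M[R]_(m, n)))).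
exists (Num.min 1 (rho / Ca)), 0; split.
- by rewrite lt_min ltr01 divr_gt0.
- by rewrite ge_min lexx.
- by rewrite lt_min ltr01 divr_gt0.
move=> x xs; have Nx : Na x <= rho.
  rewrite (le_trans (NaC _))// mulrC -ler_pdivlMr// (le_trans xs)//.
  by rewrite ge_min lexx orbT.
rewrite /g /T t0// scale0r mulmxDl [X in X - x]addrAC subrr add0r.
rewrite -scalemxAl -scalemxAr scalerA divff ?gt_eqF// scale1r -mulmxA.
rewrite mul_pid_mx minnn (minn_idPr nm) pid_mx_1 mulmx1 subrr normr0.
by [].
Qed.

End Nondegenerate.

(** * Images of small measure *)

Section Rigidity.
Variable R : realType.

(* [b] is the Busemann function of the ray spanned by the midpoint [u] of [p] and
   [q]: [b x] is the infimum of [Na (x + t *: u) - t]. *)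
Lemma busemann_function n (Na : 'rV[R]_n -> R) (p q : 'rV[R]_n) :
  is_norm Na -> Na p <= 1 -> Na q <= 1 -> Na (2^-1 *: (p + q)) = 1 ->
  exists b : 'rV[R]_n -> R,
    [/\ forall x y, b x - b y <= Na (x - y),
        forall x s, b (x + s *: p) = b x + s &
        forall x s, b (x + s *: q) = b x + s].
Proof.
move=> hNa p1 q1; set u := _ *: _ => u1.
pose S x := [set Na (x + t *: u) - t | t in [set: R]].
have Sne x : S x !=set0 by exists (Na (x + 0 *: u) - 0), 0.
have Slb x : lbound (S x) (- Na x).
  move=> _ [t _ <-]; have := is_norm_sub hNa (t *: u) (- x).
  rewrite opprK is_normN// is_normZ// u1 mulr1 [t *: u + x]addrC.
  by have := ler_norm t; lra.
have Shas x : has_lbound (S x) by exists (- Na x); exact: Slb.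
pose b x := inf (S x).
have bl x y : b x - b y <= Na (x - y).
  rewrite lerBlDr addrC -lerBlDr; apply: lb_le_inf => // _ [t _ <-].
  have h : b x <= Na (x + t *: u) - t by apply: ge_inf => //; exists t.
  have : Na (x + t *: u) <= Na (y + t *: u) + Na (x - y).
    rewrite -lerBlDl; apply: le_trans (is_norm_sub hNa _ _) _.
    by rewrite opprD addrACA subrr addr0.
  by move: h; lra.
have bu x s : b (x + s *: u) <= b x + s.
  rewrite -lerBlDr; apply: lb_le_inf => // _ [t _ <-].
  have : b (x + s *: u) <= Na (x + s *: u + (t - s) *: u) - (t - s).
    by apply: ge_inf => //; exists (t - s).
  by rewrite -addrA -scalerDl [s + _]addrC subrK; lra.
have key a c : Na a <= 1 -> Na c <= 1 -> u = 2^-1 *: (a + c) ->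
    forall x s, b (x + s *: a) = b x + s.
  move=> a1 c1 ue.
  have ge0 x s : 0 <= s -> b (x + s *: a) = b x + s.
    move=> s0; apply/eqP; rewrite eq_le; apply/andP; split.
      rewrite -lerBlDl (le_trans (bl _ _))// addrC addKr is_normZ//.
      by rewrite ger0_norm// ler_piMr.
    (* [x + s *: a + s *: c] is [x + (2 * s) *: u]: going back to [x] along [u] lowers [b] by at
       least [2 * s], while the step along [c] raised it by at most [s]. *)
    have -> : x = (x + s *: a + s *: c) + (- (2 * s)) *: u.
      by rewrite ue; apply/rowP => i; rewrite !mxE; field.
    set y := x + s *: a.
    have h1 := bu (y + s *: c) (- (2 * s)).
    have : b (y + s *: c) - b y <= s.
      rewrite (le_trans (bl _ _))// addrC addKr is_normZ//.
      by rewrite ger0_norm// ler_piMr.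
    have -> : y + s *: c + - (2 * s) *: u + s *: a = y.
      by rewrite ue; apply/rowP => i; rewrite !mxE; field.
    by move: h1; lra.
  move=> x s; have [/ge0 //|/ltW s0] := leP 0 s.
  have := @ge0 (x + s *: a) (- s); rewrite oppr_ge0 => /(_ s0).
  by rewrite scaleNr addrK; lra.
exists b; split=> //; first exact: (key p q).
by apply: (key q p) => //; rewrite addrC.
Qed.

(* [w] is a point of the unit ball of [Nb] farthest from 0 for the Euclidean
   norm, hence strongly exposed by [psi]. *)
Lemma exposed_point m (Nb : 'rV[R]_m -> R) : (0 < m)%N -> is_norm Nb ->
  exists (w : 'rV[R]_m) (psi : 'rV[R]_m -> R) (W : R),
    [/\ 0 < W /\ Nb w <= 1, forall y z, psi (y - z) = psi y - psi z,
        forall a, psi (a *: w) = a, forall y, psi y <= Nb y &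
        forall y l, Nb y <= l -> `|y - l *: w| ^+ 2 <= W * (l * (l - psi y))].
Proof.
move=> m0 hNb; pose q (y : 'rV[R]_m) := \sum_i y ord0 i ^+ 2.
have q0 y : 0 <= q y by apply: sumr_ge0 => i _; exact: sqr_ge0.
have qZ a y : q (a *: y) = a ^+ 2 * q y.
  by rewrite /q mulr_sumr; apply: eq_bigr => i _; rewrite mxE exprMn.
have [c c0 Nc] := is_norm_ge hNb.
pose S := [set y : 'rV[R]_m | Nb y <= 1].
have cS : compact S.
  apply: bounded_closed_compact.
    exists c^-1; split => [|M M1 x Sx]; first exact: num_real.
    apply: (@le_trans _ _ c^-1); last exact: ltW.
    by rewrite -[leRHS]mul1r ler_pdivlMr// mulrC (le_trans (Nc x)).
  have -> : S = Nb @^-1` [set r | r <= 1] by [].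
  apply: preimage_closed; last exact: closed_le.
  by move=> x _; exact: is_norm_continuous.
have cq : continuous q.
  apply: continuous_big => [|i _ x]; first exact: add_continuous.
  apply: (@continuous_comp _ _ _ (fun y : 'rV[R]_m => y ord0 i) (fun r => r ^+ 2)).
    exact: coord_continuous.
  exact: exprn_continuous.
have S0 : S 0 by rewrite /S /= is_norm0.
have [w] := @EVT_max_rV R m q S (ex_intro _ 0 S0) cS (continuous_subspaceT cq).
rewrite inE => Sw wmax; pose W := q w.
have qW y : q y <= W * Nb y ^+ 2.
  have [->|y0] := eqVneq y 0.
    have -> : q 0 = 0 by rewrite /q big1// => i _; rewrite mxE expr0n.
    by rewrite mulr_ge0 ?sqr_ge0 ?q0.
  have Ny : 0 < Nb y.
    by rewrite lt_def is_norm_ge0// andbT; apply: contraNneq y0 => /is_norm_eq0 ->.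
  have : q ((Nb y)^-1 *: y) <= W.
    apply: wmax; rewrite inE /S /= is_normZ// normfV ger0_norm ?is_norm_ge0//.
    by rewrite mulVf ?gt_eqF.
  by rewrite qZ exprVn mulrC ler_pdivrMr// exprn_gt0.
have W0 : 0 < W.
  rewrite lt_def q0 andbT; apply/eqP => W0.
  have := qW (const_mx 1); rewrite W0 mul0r /q.
  rewrite (eq_bigr (fun=> 1)) ?sumr_const ?card_ord; last first.
    by move=> i _; rewrite mxE expr1n.
  by rewrite leNgt ltr0n m0.
(* The Euclidean product with [w], normalised by [psi w = 1]. Expanding [q (y - l *: w)] with
   [q y <= W * l ^+ 2] leaves [2 * W * (l * (l - psi y))]. *)
pose psi (y : 'rV[R]_m) := (\sum_i y ord0 i * w ord0 i) / W.
have sqE y l : q (y - l *: w) = q y - 2 * l * (W * psi y) + l ^+ 2 * W.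
  have -> : W * psi y = \sum_i y ord0 i * w ord0 i by rewrite mulrC divfK ?gt_eqF.
  rewrite /W /q !mulr_sumr -sumrB -big_split /=.
  by apply: eq_bigr => i _; rewrite !mxE; ring.
exists w, psi, (2 * W); split.
- by rewrite mulr_gt0.
- move=> y z; rewrite /psi -mulrBl -sumrB; congr (_ / _).
  by apply: eq_bigr => i _; rewrite !mxE mulrBl.
- move=> a; rewrite /psi (eq_bigr (fun i => a * w ord0 i ^+ 2)).
    by rewrite -mulr_sumr mulfK// gt_eqF.
  by move=> i _; rewrite mxE expr2 mulrA.
- move=> y; have [->|y0] := eqVneq y 0.
    rewrite /psi big1 ?mul0r ?is_norm_ge0// => i _.
    by rewrite mxE mul0r.
  have Ny : 0 < Nb y.
    by rewrite lt_def is_norm_ge0// andbT; apply: contraNneq y0 => /is_norm_eq0 ->.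
  have := q0 (y - Nb y *: w); rewrite sqE => h; have h2 := qW y.
  have : 0 <= 2 * Nb y * W * (Nb y - psi y) by move: h h2; lra.
  by rewrite pmulr_rge0 ?subr_ge0// !mulr_gt0.
move=> y l yl; apply: (@le_trans _ _ (q (y - l *: w))).
  have [/eqP|xn0] := eqVneq `|y - l *: w| 0.
    by rewrite normr_eq0 => /eqP ->; rewrite normr0 expr0n.
  have [[i j] ij] := @mx_norm_neq0 R 1 m (y - l *: w) xn0.
  have -> : `|y - l *: w| = mx_norm (y - l *: w) by [].
  rewrite ij /= (ord1 i) real_normK ?num_real//.
  by rewrite /q (bigD1 j)//= lerDl sumr_ge0// => k _; rewrite sqr_ge0.
rewrite sqE; have h : q y <= W * l ^+ 2.
  rewrite (le_trans (qW y))// ler_pM2l// lerXn2r ?nnegrE ?is_norm_ge0//.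
  exact: le_trans (is_norm_ge0 hNb y) yl.
by move: h; lra.
Qed.

End Rigidity.

(** * Counting along lattice lines *)

Section Counting.
Variable R : realType.

Definition upd n (T : Type) (z : 'I_n -> T) (j : 'I_n) (a : T) : 'I_n -> T :=
  fun i => if i == j then a else z i.

(** Double counting: the involution exchanging [z j] and [a] shows that the sum over all lines
    counts each point [L] times. *)
Lemma fiber_count n L (j : 'I_n) (T : {ffun 'I_n -> 'I_L} -> bool) (c : R) :
  (forall z : {ffun 'I_n -> 'I_L}, \sum_(a < L) (T (finfun (upd z j a)))%:R <= c) ->
  L%:R * \sum_z (T z)%:R <= c * L%:R ^+ n.
Proof.
move=> Tc.
pose h (u : {ffun 'I_n -> 'I_L} * 'I_L) := (finfun (upd u.1 j u.2), u.1 j).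
have h_inv : involutive h.
  move=> [z a]; rewrite /h /=; congr pair; last by rewrite ffunE /upd eqxx.
  by apply/ffunP => i; rewrite !ffunE /upd !ffunE; case: eqP => // ->.
have -> : L%:R * \sum_z (T z)%:R =
    \sum_(z : {ffun 'I_n -> 'I_L}) \sum_(a < L) (T (finfun (upd z j a)))%:R :> R.
  rewrite pair_bigA (reindex_inj (inv_inj h_inv)) /=.
  rewrite -(pair_bigA _ (fun z a => (T (finfun (upd (h (z, a)).1 j (h (z, a)).2)))%:R : R)) /=.
  rewrite mulr_sumr; apply: eq_bigr => z _.
  rewrite [RHS](eq_bigr (fun=> (T z)%:R)).
    by rewrite sumr_const card_ord -[RHS]mulr_natl.
  by move=> a _; congr (T _)%:R; have [] := h_inv (z, a).
apply: (@le_trans _ _ (\sum_(z : {ffun 'I_n -> 'I_L}) c)).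
  by apply: ler_sum => z _; exact: Tc.
by rewrite sumr_const card_ffun !card_ord -[leLHS]mulr_natr natrX.
Qed.

Lemma sum_dvdn_le k L : (0 < k)%N -> \sum_(a < L) (k %| a)%:R <= L%:R / k%:R + 1 :> R.
Proof.
move=> k0; case: L => [|L].
  by rewrite big_ord0 addr_ge0// mul0r.
have -> : \sum_(a < L.+1) (k %| a)%:R = (L %/ k).+1%:R :> R.
  elim: L => [|L IH]; first by rewrite big_ord1 dvdn0 div0n.
  by rewrite big_ord_recr /= IH divnS// -natrD addnC -addnS.
rewrite -natr1 lerD2r ler_pdivlMr ?ltr0n// -natrM ler_nat.
by rewrite (leq_trans (leq_trunc_div _ _)).
Qed.

Lemma sum_window_le L (T : nat -> bool) c :
  (forall a b, T a -> T b -> (b < a + c)%N) -> \sum_(a < L) (T a)%:R <= c%:R :> R.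
Proof.
move=> Tc; rewrite -natr_sum ler_nat.
have -> : (\sum_(a < L) T a)%N = #|finset (fun a : 'I_L => T a)|.
  by rewrite -sum1_card [RHS]big_mkcond; apply: eq_bigr => a _; rewrite inE; case: (T a).
by apply: card_ord_window => a b; rewrite !inE; exact: Tc.
Qed.

(** A lattice line meets the cube only at the indices in [I]; a running maximum extends [G] to all
    indices, so that sums can telescope. *)
Lemma monotone_extension (I : nat -> bool) (G : nat -> R) (m rho : R) :
  0 <= rho ->
  (forall a b, (a <= b)%N -> I a -> I b -> G a <= G b) ->
  (forall a, I a -> m <= G a <= m + rho) ->
  exists H : nat -> R, [/\ forall a b, (a <= b)%N -> H a <= H b,
    forall a, m <= H a <= m + rho & forall a, I a -> H a = G a].
Proof.
move=> rho0 Gmono Gm; pose H a := \big[Num.max/m]_(i < a.+1 | I i) G i.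
exists H; split=> [a b ab|a|a Ia].
- apply/bigmax_leP; split=> [|i Ii]; first exact: bigmax_ge_id.
  have ib : (i < b.+1)%N by rewrite (leq_trans (ltn_ord i)).
  by apply: (@le_bigmax_cond _ _ _ m (Ordinal ib)).
- rewrite bigmax_ge_id /=; apply/bigmax_leP; split; first by rewrite lerDl.
  by move=> i /Gm /andP[].
apply/eqP; rewrite eq_le; apply/andP; split.
  apply/bigmax_leP; split; first by have /andP[] := Gm _ Ia.
  by move=> i Ii; apply: Gmono => //; rewrite -ltnS.
exact: (@le_bigmax_cond _ _ _ m (Ordinal (ltnSn a))).
Qed.

(** Around a bad index the extension rises by more than [th] between [a - k] and [a + k]; summed
    over [a], these rises telescope to at most [2 * k * rho]. *)
Lemma count_jumps (I : nat -> bool) (G : nat -> R) (m rho th : R) k L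
    (bad : nat -> bool) :
  0 <= rho -> 0 < th ->
  (forall a b, (a <= b)%N -> I a -> I b -> G a <= G b) ->
  (forall a, I a -> m <= G a <= m + rho) ->
  (forall a, bad a -> exists b c, [/\ (a - k <= b)%N, (b <= c)%N, (c <= a + k)%N,
     I b /\ I c & th < G c - G b]) ->
  \sum_(a < L) (bad a)%:R <= 2 * k%:R * rho / th.
Proof.
move=> rho0 th0 Gmono Gm badP.
have [H [Hmono Hm HG]] := monotone_extension rho0 Gmono Gm.
have osc a b : H a - H b <= rho.
  by have /andP[? ?] := Hm a; have /andP[? ?] := Hm b; lra.
have up j : \sum_(a < L) (H (a + j)%N - H a) <= j%:R * rho.
  elim: j => [|j IH]; first by rewrite mul0r big1// => a _; rewrite addn0 subrr.
  have -> : \sum_(a < L) (H (a + j.+1)%N - H a) =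
      \sum_(a < L) (H (a.+1 + j)%N - H (a + j)%N) + \sum_(a < L) (H (a + j)%N - H a).
    by rewrite -big_split; apply: eq_bigr => a _ /=; rewrite addnS addSn subrKA.
  rewrite -natr1 mulrDl mul1r addrC lerD//.
  rewrite -(big_mkord xpredT (fun a => H (a.+1 + j)%N - H (a + j)%N)).
  by rewrite (@telescope_sumr _ _ _ (fun a => H (a + j)%N)).
have down j : \sum_(a < L) (H a - H (a - j)%N) <= j%:R * rho.
  elim: j => [|j IH]; first by rewrite mul0r big1// => a _; rewrite subn0 subrr.
  have -> : \sum_(a < L) (H a - H (a - j.+1)%N) =
      \sum_(a < L) (H a - H (a - j)%N) + \sum_(a < L) (H (a - j)%N - H (a.-1 - j)%N).
    rewrite -big_split; apply: eq_bigr => a _ /=.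
    by rewrite subrKA; congr (_ - H _); lia.
  rewrite -natr1 mulrDl mul1r lerD//.
  have -> : \sum_(a < L) (H (a - j)%N - H (a.-1 - j)%N) = H (L.-1 - j)%N - H 0%N.
    elim: (L) => [|l IHl]; first by rewrite big_ord0 sub0n subrr.
    by rewrite big_ord_recr IHl /= addrC subrKA.
  exact: osc.
rewrite ler_pdivlMr//; apply: (@le_trans _ _ (k%:R * rho + k%:R * rho)); last first.
  by rewrite (_ : 2 * k%:R * rho = k%:R * rho + k%:R * rho)//; ring.
apply: le_trans (lerD (up k) (down k)).
rewrite -big_split /= mulr_suml; apply: ler_sum => a _.
have [/badP[b [c [ab bc ca [Ib Ic] thG]]]|_] := boolP (bad a); last first.
  by rewrite mul0r addr_ge0// subr_ge0 Hmono// ?leq_addr ?leq_subr.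
rewrite mul1r addrA subrK; move: thG; rewrite -!HG//.
have := Hmono _ _ ab; have := Hmono _ _ ca; lra.
Qed.

End Counting.

Section FiniteCover.
Variable R : realType.

Lemma hausdorff_pre_ball_cover k n (A : set 'rV[R]_k) (s : seq 'rV[R]_k) (r delta : R) :
  0 <= r -> 2 * k%:R * r <= delta ->
  (forall y, A y -> exists2 c, c \in s & `|y - c| <= r) ->
  (hausdorff_pre n delta A <= ((size s)%:R * (2 * k%:R * r) ^+ n)%:E)%E.
Proof.
move=> r0 rd As.
(* Empty sets pad the sequence; their [diam_pow] is 0 even for exponent 0. *)
pose E i : set 'rV[R]_k :=
  if (i < size s)%N then [set y | `|y - nth 0 s i| <= r] else set0.
have kr0 : 0 <= 2 * k%:R * r by rewrite !mulr_ge0.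
have Ed i : (diam (E i) <= (2 * k%:R * r)%:E)%E.
  apply: diam_le => // x y; rewrite /E; case: ifP => //= _ xr yr.
  rewrite (le_trans (eucl_le_norm _ _))//.
  have -> : 2 * k%:R * r = k%:R * (r + r) by ring.
  rewrite ler_wpM2l// (le_trans (ler_distD (nth 0 s i) _ _))//.
  by apply: lerD => //; rewrite distrC.
apply: (@le_trans _ _ (\sum_(0 <= i <oo) diam_pow n (E i))%E).
  apply: ereal_inf_lbound; exists E => //; split=> [y /As[c cs yc]|i].
    by exists (index c s) => //; rewrite /E index_mem cs /= nth_index.
  by rewrite (le_trans (Ed i))// lee_fin.
rewrite (@nneseries_split _ _ 0%N (size s)); last by move=> i _; exact: diam_pow_ge0.
rewrite [X in (_ + X)%E]eseries0 ?adde0; last first.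
  move=> i si _; rewrite /E ltnNge si /= /diam_pow.
  by case: asboolP.
rewrite add0n big_mkord.
apply: (@le_trans _ _ (\sum_(i < size s) ((2 * k%:R * r) ^+ n)%:E)%E).
  apply: lee_sum => i _; rewrite /diam_pow; case: ifP => _.
    by rewrite lee_fin exprn_ge0.
  have dfin : diam (E i) \is a fin_num.
    by rewrite ge0_fin_numE ?diam_ge0// (le_lt_trans (Ed i))// ltry.
  rewrite lee_fin lerXn2r ?nnegrE ?fine_ge0 ?diam_ge0//.
  by rewrite -lee_fin fineK.
by rewrite sumEFin lee_fin sumr_const card_ord -[leLHS]mulr_natl.
Qed.

End FiniteCover.

Section Basis.
Variable R : realType.

(** Exchange: [p] and [q] replace the rows of the identity at the pivots [i1] and [i2] found by
    elimination. *)
Lemma two_vector_basis n (p q : 'rV[R]_n) :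
  p != 0 -> (forall c, q != c *: p) ->
  exists (A : 'M[R]_n) (i1 i2 : 'I_n),
    [/\ A \in unitmx, i1 != i2, row i1 A = p & row i2 A = q].
Proof.
move=> p0 qp.
have nz (v : 'rV[R]_n) : v != 0 -> exists i, v ord0 i != 0.
  move=> v0; apply: contrapT => h; case/eqP: v0; apply/rowP => i.
  rewrite mxE; apply/eqP; apply: contrapT => vi; apply: h; exists i.
  exact/negP.
have [i1 pi1] := nz _ p0.
pose q' := q - (q ord0 i1 / p ord0 i1) *: p.
have q'0 : q' != 0 by rewrite subr_eq0 qp.
have [i2 qi2] := nz _ q'0.
have i12 : i1 != i2.
  by apply: contraNneq qi2 => <-; rewrite !mxE divfK// subrr.
pose A : 'M[R]_n := \matrix_(i, j)
  if i == i1 then p ord0 j else if i == i2 then q ord0 j else (i == j)%:R.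
exists A, i1, i2; split=> //; last 2 first.
- by apply/rowP => j; rewrite !mxE eqxx.
- by apply/rowP => j; rewrite !mxE eq_sym (negPf i12) eqxx.
rewrite unitmxE unitfE; apply/negP => /det0P[v v0 vA].
have col j : v ord0 i1 * p ord0 j + v ord0 i2 * q ord0 j +
    \sum_(i | (i != i1) && (i != i2)) v ord0 i * (i == j)%:R = 0.
  move/rowP: vA => /(_ j); rewrite !mxE (bigD1 i1)//= (bigD1 i2) 1?eq_sym//=.
  rewrite !mxE eqxx eq_sym (negPf i12) eqxx addrA => vA0; rewrite -[RHS]vA0; congr (_ + _).
  by apply: eq_bigr => i /andP[/negPf ii1 /negPf ii2]; rewrite mxE ii1 ii2.
have col1 := col i1; have col2 := col i2.
rewrite big1 ?addr0 in col1; last by move=> i /andP[/negPf -> _]; rewrite mulr0.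
rewrite big1 ?addr0 in col2; last by move=> i /andP[_ /negPf ->]; rewrite mulr0.
move: qi2; rewrite !mxE => qi2.
have v2 : v ord0 i2 = 0.
  have : v ord0 i2 * (q ord0 i2 - q ord0 i1 / p ord0 i1 * p ord0 i2) = 0.
    transitivity ((v ord0 i1 * p ord0 i2 + v ord0 i2 * q ord0 i2) -
      (v ord0 i1 * p ord0 i1 + v ord0 i2 * q ord0 i1) / p ord0 i1 * p ord0 i2).
      by field.
    by rewrite col1 col2 !mul0r subrr.
  by move/eqP; rewrite mulf_eq0 (negPf qi2) orbF => /eqP.
have v1 : v ord0 i1 = 0.
  by move/eqP: col1; rewrite v2 mul0r addr0 mulf_eq0 (negPf pi1) orbF => /eqP.
case/eqP: v0; apply/rowP => j; rewrite mxE.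
have [->//|ji1] := eqVneq j i1; have [->//|ji2] := eqVneq j i2.
have := col j; rewrite v1 v2 !mul0r !add0r (bigD1 j) ?ji1//= eqxx mulr1.
by rewrite big1 ?addr0// => i /andP[_ /negPf ->]; rewrite mulr0.
Qed.

End Basis.

(** * Covering the image from few lattice points *)

Section Lattice.
Variables (R : realType) (n : nat) (A : 'M[R]_n) (M t : R).

Definition lattice_point (Z : 'I_n -> nat) : 'rV[R]_n :=
  (\row_j (t * (Z j)%:R - M)) *m A.

Lemma lattice_point_shift j (Z Z' : 'I_n -> nat) :
  (forall i, i != j -> Z' i = Z i) ->
  lattice_point Z' = lattice_point Z + (t * ((Z' j)%:R - (Z j)%:R)) *: row j A.
Proof.
move=> ZZ'; apply/eqP; rewrite addrC -subr_eq -mulmxBl rowE scalemxAl; apply/eqP.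
congr (_ *m _); apply/rowP => i; rewrite !mxE eqxx /=.
by have [->|ij] := eqVneq i j; [rewrite mulr1; ring | rewrite mulr0 ZZ'// subrr].
Qed.

End Lattice.

Section LatticeCover.
Variables (R : realType) (n m : nat).
Variables (Na : 'rV[R]_n -> R) (Nb : 'rV[R]_m -> R).
Hypotheses (hNa : is_norm Na) (hNb : is_norm Nb).
Variables (b : 'rV[R]_n -> R) (w : 'rV[R]_m) (psi : 'rV[R]_m -> R) (W : R).
Hypotheses (W0 : 0 < W) (psiB : forall y z, psi (y - z) = psi y - psi z)
  (psiw : forall a, psi (a *: w) = a) (psi_le : forall y, psi y <= Nb y)
  (psi_exposed : forall y l, Nb y <= l ->
     `|y - l *: w| ^+ 2 <= W * (l * (l - psi y))).
Variables (A : 'M[R]_n) (i1 i2 : 'I_n).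
Hypotheses (Aunit : A \in unitmx) (i12 : i1 != i2).
Hypotheses (Ni1 : Na (row i1 A) <= 1) (Ni2 : Na (row i2 A) <= 1).
Hypotheses (bi1 : forall x s, b (x + s *: row i1 A) = b x + s)
  (bi2 : forall x s, b (x + s *: row i2 A) = b x + s).
Variables (f : 'rV[R]_n -> 'rV[R]_m) (r : R).
Hypotheses (Lf : Lip1 Na Nb f)
  (fr : forall x, cube x -> Nb (f x - b x *: w) <= r).
Variables (K CA M0 : R).
Hypotheses (CA0 : 0 < CA) (M00 : 0 < M0) (K0 : 0 < K).
Hypotheses (fK : forall x y, `|x| <= 1 -> `|y| <= 1 -> `|f x - f y| <= K * `|x - y|)
  (AC : forall y : 'rV[R]_n, `|y *m A| <= CA * `|y|)
  (AM : forall y : 'rV[R]_n, `|y *m invmx A| <= M0 * `|y|).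
Variables (k cs L' : nat).
Hypothesis k0 : (0 < k)%N.
Hypothesis csP : forall i, exists j,
  k%:R * (`|row i1 A| + `|row i2 A|) + CA < cs%:R * `|A j i|.

Let L := L'.+1.
(** [M0] bounds the coordinates of the cube in the basis [A]; the margin 1 keeps indices strictly
    below [L]. *)
Let t : R := 2 * (M0 + 1) / L%:R.
Let pt := lattice_point A (M0 + 1) t.
Let IC Z := `|pt Z| <= 1.
(** The admissible defect: for a move of length at most [t * k], strong exposedness bounds the
    squared error by [W * (t * k) * th = W * t ^+ 2], so the error is of the order of the mesh. *)
Let th := t / k%:R.

Let t0 : 0 < t.
Proof. by rewrite divr_gt0 ?mulr_gt0 ?addr_gt0. Qed.

Let tL : t * L%:R = 2 * (M0 + 1).
Proof. by rewrite /t divfK// pnatr_eq0. Qed.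

Let th0 : 0 < th.
Proof. by rewrite divr_gt0 ?ltr0n. Qed.

Let psi_abs y : `|psi y| <= Nb y.
Proof.
have psi0 : psi 0 = 0 by rewrite -(scale0r w) psiw.
rewrite ler_norml psi_le andbT lerNl -[X in X <= _]add0r -psi0 -psiB sub0r.
by rewrite (le_trans (psi_le _))// is_normN.
Qed.

Let r0 : 0 <= r.
Proof. by rewrite (le_trans _ (fr (@cube0 R n)))// is_norm_ge0. Qed.

Let pt_upd j (Z : 'I_n -> nat) a c :
  pt (upd Z j c) = pt (upd Z j a) + (t * (c%:R - a%:R)) *: row j A.
Proof.
rewrite /pt (@lattice_point_shift _ _ A _ _ j (upd Z j a)).
  by rewrite /upd eqxx.
by move=> j' /negPf jj; rewrite /upd jj.
Qed.

(** The defect [G] is monotone because [psi \o f] is 1-Lipschitz along the line, and stays within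
    [r] of a constant because [b] has slope exactly 1 there. *)
Let line_count i (Z : 'I_n -> nat) (bad : nat -> bool) :
  Na (row i A) <= 1 -> (forall x s, b (x + s *: row i A) = b x + s) ->
  (forall a, bad a -> exists c e, [/\ (a - k <= c)%N, (c <= e)%N, (e <= a + k)%N,
     IC (upd Z i c) /\ IC (upd Z i e) &
     th < t * (e - c)%:R - psi (f (pt (upd Z i e)) - f (pt (upd Z i c)))]) ->
  \sum_(a < L) (bad a)%:R <= 2 * k%:R * (2 * r) / th.
Proof.
move=> Ni bi badP.
pose G a := t * a%:R - psi (f (pt (upd Z i a))).
apply: (@count_jumps R (fun a => IC (upd Z i a)) G (- b (pt (upd Z i 0%N)) - r)
  (2 * r) th k L bad) => //.
- by rewrite mulr_ge0.
- move=> a c ac ICa ICc; rewrite /G.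
  have cx : cube (pt (upd Z i a)) by apply/cubeE.
  have cx' : cube (pt (upd Z i c)) by apply/cubeE.
  have := le_trans (psi_le _) (Lf.2 _ _ cx' cx).
  rewrite {2}(pt_upd i Z a c) [X in Na X]addrAC subrr add0r is_normZ// => h.
  have tac : 0 <= t * (c%:R - a%:R) by rewrite mulr_ge0 ?subr_ge0 ?ler_nat// ltW.
  have : psi (f (pt (upd Z i c)) - f (pt (upd Z i a))) <= t * (c%:R - a%:R).
    by rewrite (le_trans h)// ger0_norm// ler_piMr.
  by rewrite psiB; lra.
- move=> a ICa; have cx : cube (pt (upd Z i a)) by apply/cubeE.
  have := le_trans (psi_abs _) (fr cx); rewrite psiB psiw /G (pt_upd i Z 0%N a) bi.
  by rewrite subr0 ler_norml => /andP[? ?]; apply/andP; lra.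
move=> a /badP[c [e [ac ce ea [ICc ICe] h]]].
exists c, e; split=> //; move: h; rewrite /G psiB natrB//; lra.
Qed.

(* [Z] is compared with [sd Z], reached by going back along row [i1] to the
   previous multiple of [k] and then forward by as many steps along row [i2].
   Unless one of these two moves is not stretched enough ([bad1], [bad2]) or leaves
   the cube ([shell]), [f] takes nearly the same value at both points, so that one
   may keep only the points whose coordinate [i1] is a multiple of [k]. *)
Let dn (Z : 'I_n -> nat) := upd Z i1 (Z i1 - Z i1 %% k)%N.
Let sd (Z : 'I_n -> nat) := upd (dn Z) i2 (Z i2 + Z i1 %% k)%N.
Let bad1 Z := [&& IC Z, IC (dn Z) &
  th < t * (Z i1 %% k)%:R - psi (f (pt Z) - f (pt (dn Z)))].
Let bad2 Z := [&& IC (dn Z), IC (sd Z) &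
  th < t * (Z i1 %% k)%:R - psi (f (pt (sd Z)) - f (pt (dn Z)))].
Let lam := t * k%:R * (`|row i1 A| + `|row i2 A|).
Let shell (i : 'I_n) Z := (1 - lam < `|pt Z ord0 i|) && (`|pt Z ord0 i| <= 1 + CA * t).

Let modk (a : nat) : (a %% k <= k)%N. Proof. by rewrite ltnW// ltn_pmod. Qed.

Let bad1_count (Z : 'I_n -> nat) : \sum_(a < L) (bad1 (upd Z i1 (a : nat)))%:R <=
  2 * k%:R * (2 * r) / th.
Proof.
apply: (@line_count i1 Z (fun a => bad1 (upd Z i1 a))) => // a /and3P[].
have -> : dn (upd Z i1 a) = upd Z i1 (a - a %% k)%N.
  by apply/funext => i; rewrite /dn /upd eqxx; case: eqP.
move=> ICa ICb; rewrite {1}/upd eqxx => h.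
exists (a - a %% k)%N, a; split=> //.
- by rewrite leq_sub2l.
- by rewrite leq_subr.
- by rewrite leq_addr.
- by rewrite subKn// leq_mod.
Qed.

Let bad2_count (Z : 'I_n -> nat) : \sum_(a < L) (bad2 (upd Z i2 (a : nat)))%:R <=
  2 * k%:R * (2 * r) / th.
Proof.
apply: (@line_count i2 (dn Z) (fun a => bad2 (upd Z i2 a))) => // a.
have Zi1 : upd Z i2 a i1 = Z i1 by rewrite /upd (negPf i12).
have dnE : dn (upd Z i2 a) = upd (dn Z) i2 a.
  apply/funext => i; rewrite /dn Zi1 /upd; case: eqP => // ->.
  by rewrite (negPf i12).
have sdE : sd (upd Z i2 a) = upd (dn Z) i2 (a + Z i1 %% k)%N.
  by apply/funext => i; rewrite /sd Zi1 dnE /upd; case: eqP => //; rewrite eqxx.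
rewrite /bad2 sdE dnE Zi1 => /and3P[ICa ICb h].
exists a, (a + Z i1 %% k)%N; split=> //.
- by rewrite leq_subr.
- by rewrite leq_addr.
- by rewrite leq_add2l.
- by rewrite addKn.
Qed.

(** The width of the shell is a fixed multiple of [t], so a line in a direction [j] with
    [A j i != 0] meets each of its two sides in at most [cs] points. *)
Let shell_count i : exists j, forall Z : 'I_n -> nat,
  \sum_(a < L) (shell i (upd Z j (a : nat)))%:R <= 2 * cs%:R :> R.
Proof.
have [j jP] := csP i; exists j => Z.
pose T (e : R) a := (1 - lam < e * pt (upd Z j a) ord0 i) &&
  (e * pt (upd Z j a) ord0 i <= 1 + CA * t).
have Tsum e : e ^+ 2 = 1 -> \sum_(a < L) (T e a)%:R <= cs%:R :> R.
  move=> e2; apply: sum_window_le => a c /andP[a1 a2] /andP[c1 c2].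
  rewrite ltnNge; apply/negP => ac.
  have shift : pt (upd Z j c) ord0 i - pt (upd Z j a) ord0 i =
      t * (c%:R - a%:R) * A j i.
    rewrite (pt_upd j Z a c); move: (pt (upd Z j a)) => u.
    by rewrite !mxE addrAC subrr add0r.
  have ca : cs%:R <= c%:R - a%:R :> R.
    by rewrite lerBrDl -natrD ler_nat.
  have n1 : `|e| = 1.
    by apply/eqP; rewrite -(@eqrXn2 _ 2)// real_normK ?num_real// e2 expr1n.
  have : `|t * (c%:R - a%:R) * A j i| <= lam + CA * t.
    rewrite -shift -[leLHS]mul1r -n1 -normrM mulrBr ler_norml.
    by apply/andP; lra.
  rewrite -mulrA [X in X <= _]normrM (gtr0_norm t0) normrM.
  rewrite (ger0_norm (le_trans (ler0n _ _) ca)).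
  apply/negP; rewrite -ltNge /lam.
  have : t * (k%:R * (`|row i1 A| + `|row i2 A|) + CA) < t * (cs%:R * `|A j i|).
    by rewrite ltr_pM2l.
  have : t * (cs%:R * `|A j i|) <= t * ((c%:R - a%:R) * `|A j i|).
    by rewrite ler_pM2l// ler_wpM2r.
  by lra.
apply: (@le_trans _ _ (\sum_(a < L) ((T 1 a)%:R + (T (-1) a)%:R))).
  apply: ler_sum => a _; rewrite /shell /T mul1r mulN1r.
  case: (boolP (_ && _)) => [sh|_]; last by rewrite addr_ge0.
  have [x0|x0] := leP 0 (pt (upd Z j a) ord0 i).
    by move: sh; rewrite ger0_norm// => ->; rewrite lerDl.
  by move: sh; rewrite ltr0_norm// => ->; rewrite lerDr.
by rewrite big_split mulr_natl mulr2n lerD// Tsum// ?sqrrN expr1n.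
Qed.

Let val_fun (z : {ffun 'I_n -> 'I_L}) : 'I_n -> nat := fun i => z i.
Let S (z : {ffun 'I_n -> 'I_L}) :=
  [|| (k %| z i1)%N, bad1 (val_fun z), bad2 (val_fun z) |
  [exists i, shell i (val_fun z)]].

Let val_fun_upd (z : {ffun 'I_n -> 'I_L}) j (a : 'I_L) :
  val_fun (finfun (upd z j a)) = upd (val_fun z) j (a : nat).
Proof. by apply/funext => i; rewrite /val_fun ffunE /upd; case: eqP. Qed.

(** The multiples of [k] and the two jump counts have a share independent of [L], as [th] is of
    order [L^-1]; the [+ 1] and the shells are bounded per line, hence negligible for large [L]. *)
Let S_count : L%:R * \sum_z (S z)%:R <=
  (L%:R / k%:R + 1 + 2 * (2 * k%:R * (2 * r) / th) + n%:R * (2 * cs%:R)) * L%:R ^+ n.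
Proof.
apply: (@le_trans _ _ (L%:R * \sum_(z : {ffun 'I_n -> 'I_L}) ((k %| z i1)%N%:R +
    (bad1 (val_fun z))%:R +
    (bad2 (val_fun z))%:R + \sum_i (shell i (val_fun z))%:R))).
  rewrite ler_pM2l ?ltr0n//; apply: ler_sum => z _.
  have sh0 : 0 <= \sum_i (shell i (val_fun z))%:R :> R by apply: sumr_ge0 => i _.
  rewrite /S; have [_|_] := boolP (k %| z i1)%N.
    by rewrite -!addrA lerDl !addr_ge0.
  have [_|_] := boolP (bad1 _); first by rewrite add0r -!addrA lerDl addr_ge0.
  have [_|_] := boolP (bad2 _); first by rewrite !add0r lerDl.
  rewrite !add0r; case: (boolP [exists i, shell i (val_fun z)]) => [/existsP[i si]|_];
    last exact: sh0.
  by rewrite (bigD1 i)//= si lerDl sumr_ge0.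
set B := 2 * k%:R * (2 * r) / th.
have fc j (T : {ffun 'I_n -> 'I_L} -> bool) (c : R) := @fiber_count R n L j T c.
have h1 : L%:R * \sum_(z : {ffun 'I_n -> 'I_L}) (k %| z i1)%N%:R <=
    (L%:R / k%:R + 1) * L%:R ^+ n :> R.
  apply: (fc i1 (fun z => k %| z i1)%N) => z.
  under eq_bigr do rewrite ffunE /upd eqxx.
  exact: sum_dvdn_le.
have h2 : L%:R * \sum_z (bad1 (val_fun z))%:R <= B * L%:R ^+ n.
  apply: (fc i1 (fun z => bad1 (val_fun z))) => z.
  by under eq_bigr do rewrite val_fun_upd; exact: bad1_count.
have h3 : L%:R * \sum_z (bad2 (val_fun z))%:R <= B * L%:R ^+ n.
  apply: (fc i2 (fun z => bad2 (val_fun z))) => z.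
  by under eq_bigr do rewrite val_fun_upd; exact: bad2_count.
have h4 : L%:R * \sum_z \sum_i (shell i (val_fun z))%:R <=
    n%:R * (2 * cs%:R) * L%:R ^+ n :> R.
  rewrite exchange_big mulr_sumr /=.
  apply: (@le_trans _ _ (\sum_(i < n) 2 * cs%:R * L%:R ^+ n)); last first.
    by rewrite sumr_const card_ord -[leLHS]mulr_natl mulrA.
  apply: ler_sum => i _; have [j shj] := shell_count i.
  apply: (fc j (fun z => shell i (val_fun z))) => z.
  by under eq_bigr do rewrite val_fun_upd; exact: shj.
rewrite !big_split /= !mulrDr.
apply: le_trans (lerD (lerD (lerD h1 h2) h3) h4) _.
rewrite -!mulrDl le_eqVlt.
by rewrite (_ : _ + n%:R * _ = L%:R / k%:R + 1 + 2 * B + n%:R * (2 * cs%:R)) ?eqxx//; ring.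
Qed.

Let rigid_step i x l : Na (row i A) <= 1 -> 0 <= l -> l <= t * k%:R ->
  cube x -> cube (x + l *: row i A) ->
  l - psi (f (x + l *: row i A) - f x) <= th ->
  `|f (x + l *: row i A) - f x - l *: w| <= (W + 1) * t.
Proof.
move=> Ni l0 ltk cx cx' defl.
have Nl : Nb (f (x + l *: row i A) - f x) <= l.
  rewrite (le_trans (Lf.2 _ _ cx' cx))// addrAC subrr add0r is_normZ//.
  by rewrite ger0_norm// ler_piMr.
have W1 : 0 <= (W + 1) * t by rewrite mulr_ge0 ?addr_ge0 ?ltW.
rewrite -(@ler_pXn2r _ 2)// ?nnegrE//; apply: (le_trans (psi_exposed Nl)).
apply: (@le_trans _ _ (W * t ^+ 2)).
  rewrite ler_pM2l//; apply: (@le_trans _ _ (l * th)); first exact: ler_wpM2l.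
  apply: (@le_trans _ _ (t * k%:R * th)); first by rewrite ler_pM2r.
  by rewrite /th mulrACA divff ?pnatr_eq0 -?lt0n// mulr1.
rewrite [leRHS]exprMn ler_pM2r ?exprn_gt0//; have := W0; nra.
Qed.

(** Ensures that [sd Z], once in the cube, is among the indexed points. *)
Let coord_lt Z i : IC Z -> (Z i < L)%N.
Proof.
move=> ICZ; have := AM (pt Z); rewrite mulmxK// => h.
have := le_trans (coord_le_norm _ i) h; rewrite mxE => {}h.
have tZ : t * (Z i)%:R <= M0 + (M0 + 1).
  rewrite -lerBlDr (le_trans (ler_norm _))// (le_trans h)//.
  by rewrite ler_piMr// ltW.
by rewrite -(ltr_nat R) -(ltr_pM2l t0) tL; lra.
Qed.

Let nearest x : cube x -> exists2 z : {ffun 'I_n -> 'I_L},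
  `|x - pt (val_fun z)| <= CA * t & `|pt (val_fun z)| <= 1 + CA * t.
Proof.
move=> /cubeE x1; pose y := x *m invmx A.
have yM j : `|y ord0 j| <= M0.
  rewrite (le_trans (coord_le_norm _ _))// (le_trans (AM _))// ler_piMr//.
  exact: ltW.
pose v j := (y ord0 j + (M0 + 1)) / t.
have v0 j : 0 <= v j.
  rewrite divr_ge0 ?(ltW t0)//; have := yM j; rewrite ler_norml => /andP[? ?]; lra.
have vL j : v j < L%:R.
  rewrite ltr_pdivrMr// mulrC tL; have := yM j; rewrite ler_norml => /andP[? ?].
  by have := M00; lra.
have trL j : (Num.truncn (v j) < L)%N.
  rewrite -(ltr_nat R) (le_lt_trans _ (vL j))//.
  by have /andP[] := truncn_itv (v0 j).
pose z : {ffun 'I_n -> 'I_L} := [ffun j => inord (Num.truncn (v j))].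
have zE j : val_fun z j = Num.truncn (v j) by rewrite /val_fun ffunE inordK.
have xz : `|x - pt (val_fun z)| <= CA * t.
  rewrite -{1}(mulmxKV Aunit x) -mulmxBl (le_trans (AC _))// ler_pM2l//.
  apply: norm_le_coord => [|j]; first exact: ltW.
  have -> : (x *m invmx A - \row_j0 (t * (val_fun z j0)%:R - (M0 + 1))) ord0 j =
      y ord0 j - (t * (val_fun z j)%:R - (M0 + 1)).
    have subE (u u' : 'rV[R]_n) : (u - u') ord0 j = u ord0 j - u' ord0 j by rewrite !mxE.
    by rewrite subE [X in _ - X]mxE.
  have -> : y ord0 j - (t * (val_fun z j)%:R - (M0 + 1)) =
      t * (v j - (val_fun z j)%:R).
    rewrite mulrBr /v [t * (_ / _)]mulrC divfK ?(gt_eqF t0)//.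
    by move: (y ord0 j) => y'; ring.
  have /andP[tr1 tr2] := truncn_itv (v0 j).
  rewrite zE normrM (gtr0_norm t0) ger0_norm ?subr_ge0//.
  by rewrite ler_piMr ?(ltW t0)//; move: tr2; rewrite -natr1; lra.
exists z => //.
rewrite -(subrK x (pt _)) addrC (le_trans (ler_normD _ _))// lerD//.
by rewrite distrC.
Qed.

Lemma lattice_cover : exists s : seq 'rV[R]_m,
  L%:R * (size s)%:R <=
    (L%:R / k%:R + 1 + 2 * (2 * k%:R * (2 * r) / th) + n%:R * (2 * cs%:R)) * L%:R ^+ n
  /\ forall x, cube x -> exists2 c, c \in s &
       `|f x - c| <= (K * CA + 2 * (W + 1)) * t.
Proof.
(* Points of [S] may lie outside the cube, hence [clamp]. *)
exists [seq f (clamp (pt (val_fun z))) | z <- enum S]; split.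
  rewrite size_map -cardE -sum1_card natr_sum big_mkcond /=.
  apply: le_trans S_count; rewrite ler_pM2l ?ltr0n//.
  by apply: ler_sum => z _; rewrite -[z \in _]/(S z); case: (S z).
move=> x cx; have [z xz z1] := nearest cx.
have fxz : `|f x - f (clamp (pt (val_fun z)))| <= K * CA * t.
  rewrite -{1}(clamp_id (iffLR (cubeE x) cx)).
  rewrite (le_trans (fK (clamp_norm_le _) (clamp_norm_le _)))//.
  rewrite -mulrA ler_pM2l// (le_trans (clamp_lipschitz _ _))//.
have W2 : 0 <= 2 * (W + 1) * t.
  by rewrite (mulr_ge0 _ (ltW t0))// mulr_ge0// addr_ge0// ltW.
have [Sz|Sz] := boolP (S z).
  exists (f (clamp (pt (val_fun z)))); first by apply: map_f; rewrite mem_enum.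
  by rewrite (le_trans fxz)// mulrDl lerDl.
move: Sz; rewrite /S !negb_or => /and4P[_ b1 b2 /existsPn sh].
move: (val_fun z) fxz z1 b1 b2 sh => Z fxz z1 b1 b2 sh {xz}.
have lam0 : 0 <= lam.
  by rewrite /lam mulr_ge0 ?addr_ge0// (mulr_ge0 (ltW t0)).
(* A nearest lattice point satisfies the upper bound of [shell], so avoiding the shell means lying
   at depth [lam], which pays for both moves. *)
have deep i : `|pt Z ord0 i| <= 1 - lam.
  have := sh i; rewrite /shell negb_and -leNgt => /orP[//|/negP[]].
  exact: le_trans (coord_le_norm _ _) z1.
have Zdeep : `|pt Z| <= 1 - lam.
  by apply: norm_le_coord => //; exact: le_trans (deep i1).
have IC0 : IC Z by rewrite /IC (le_trans Zdeep)// gerBl.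
pose j := (Z i1 %% k)%N; pose l := t * j%:R.
have l0 : 0 <= l by rewrite (mulr_ge0 (ltW t0)).
have ltk : l <= t * k%:R by rewrite ler_pM2l// ler_nat modk.
have ptZ : pt Z = pt (dn Z) + l *: row i1 A.
  rewrite /dn (pt_upd i1 Z (Z i1)); have -> : upd Z i1 (Z i1) = Z.
    by apply/funext => i; rewrite /upd; case: eqP => // ->.
  rewrite natrB ?leq_mod// -addrA -scalerDl /l -mulrDr.
  by rewrite (_ : _ - _ - _ + _ = 0) ?mulr0 ?scale0r ?addr0//; ring.
have ptsd : pt (sd Z) = pt (dn Z) + l *: row i2 A.
  rewrite /sd (pt_upd i2 (dn Z) (Z i2)).
  have -> : upd (dn Z) i2 (Z i2) = dn Z.
    apply/funext => i; rewrite /upd; case: eqP => // ->.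
    by rewrite /dn /upd eq_sym (negPf i12).
  by rewrite natrD addrAC subrr add0r.
have l1 : `|l *: row i1 A| + `|l *: row i2 A| <= lam.
  rewrite (normrZ l (row i1 A)) (normrZ l (row i2 A)) -mulrDr (ger0_norm l0).
  by rewrite ler_wpM2r// addr_ge0.
have IC1 : IC (dn Z).
  rewrite /IC; have -> : pt (dn Z) = pt Z - l *: row i1 A by rewrite ptZ addrK.
  rewrite (le_trans (ler_normB _ _))//.
  by have := normr_ge0 (l *: row i2 A); move: Zdeep l1; lra.
have IC2 : IC (sd Z).
  rewrite /IC ptsd; have -> : pt (dn Z) = pt Z - l *: row i1 A by rewrite ptZ addrK.
  rewrite (le_trans (ler_normD _ _))//; have := ler_normB (pt Z) (l *: row i1 A).
  by move: Zdeep l1; lra.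
move: b1 b2; rewrite /bad1 /bad2 IC0 IC1 IC2 /= -!leNgt => b1 b2.
have c0 := iffRL (cubeE _) IC0; have c1 := iffRL (cubeE _) IC1.
have c2 := iffRL (cubeE _) IC2.
have s1 : `|f (pt Z) - f (pt (dn Z)) - l *: w| <= (W + 1) * t.
  by rewrite {1}ptZ; apply: rigid_step => //; rewrite -ptZ.
have s2 : `|f (pt (sd Z)) - f (pt (dn Z)) - l *: w| <= (W + 1) * t.
  by rewrite {1}ptsd; apply: rigid_step => //; rewrite -ptsd.
pose z' : {ffun 'I_n -> 'I_L} := [ffun i => inord (sd Z i)].
have z'E : val_fun z' = sd Z.
  by apply/funext => i; rewrite /val_fun ffunE inordK// coord_lt.
exists (f (clamp (pt (val_fun z')))).
  apply: map_f; rewrite mem_enum unfold_in /S; apply/orP; left.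
  rewrite -[nat_of_ord _]/(val_fun z' i1) z'E /sd /dn /upd (negPf i12) eqxx.
  by rewrite {1}(divn_eq (Z i1) k) addnK dvdn_mull.
rewrite z'E clamp_id//; move: fxz; rewrite clamp_id// => fxz.
have : `|f (pt Z) - f (pt (sd Z))| <= 2 * (W + 1) * t.
  have -> : f (pt Z) - f (pt (sd Z)) = (f (pt Z) - f (pt (dn Z)) - l *: w) -
      (f (pt (sd Z)) - f (pt (dn Z)) - l *: w).
    move: (f (pt Z)) (f (pt (sd Z))) (f (pt (dn Z))) => u1 u2 u3.
    by apply/rowP => i; rewrite !mxE; ring.
  rewrite (le_trans (ler_normB _ _))//; move: s1 s2; lra.
have := ler_distD (f (pt Z)) (f x) (f (pt (sd Z))); move: fxz; lra.
Qed.

End LatticeCover.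

(** * Choice of constants for a ball of maps with small images *)

Section SmallImages.
Variables (R : realType) (n m : nat).
Variables (Na : 'rV[R]_n -> R) (Nb : 'rV[R]_m -> R).
Hypotheses (hNa : is_norm Na) (hNb : is_norm Nb).
Local Notation L := (Lip1 Na Nb).
Local Notation d := (@supdist R n m Nb).

(** If [u - v = c *: (u + v)], then [u = ((1 + c) / 2) *: (u + v)]; norm 1 here and both endpoints
    in the ball force [c = 1], that is [v = 0]. *)
Lemma non_extremal_segment u : Na u = 1 -> ~ extremal (unit_ball Na) u ->
  exists p q, [/\ Na p <= 1, Na q <= 1, Na (2^-1 *: (p + q)) = 1, p != 0 &
    forall c, q != c *: p].
Proof.
move=> u1 hu.
have [v [v0 pv qv]] : exists v, [/\ v != 0, Na (u + v) <= 1 & Na (u - v) <= 1].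
  apply: contrapT => h; apply: hu; split; first by rewrite /unit_ball /= u1.
  move=> v pv qv; apply: contrapT => /eqP v0; apply: h; exists v.
  by split=> //.
have uE : u = 2^-1 *: ((u + v) + (u - v)).
  by apply/rowP => i; rewrite !mxE; field.
exists (u + v), (u - v); split=> //; first by rewrite -uE.
  apply: contraTneq qv => p0; rewrite -ltNge.
  have -> : u - v = 2 *: u.
    have -> : v = - u by apply/eqP; rewrite -addr_eq0 addrC p0.
    by apply/rowP => i; rewrite !mxE; ring.
  by rewrite is_normZ// u1 mulr1 ger0_norm// ltr1n.
move=> c; apply/eqP => qc.
have c1 : c != 1.
  apply: contraNneq v0 => c1; move: qc; rewrite c1 scale1r => /rowP h.
  apply/eqP/rowP => i; have := h i; rewrite !mxE; lra.
have h1 : 1 <= (1 + c) / 2 * Na (u + v) \/ 1 <= - ((1 + c) / 2) * Na (u + v).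
  have : u = ((1 + c) / 2) *: (u + v).
    rewrite {1}uE qc; apply/rowP => i; rewrite !mxE; ring.
  move/(congr1 Na); rewrite u1 is_normZ// => NE.
  have [c0|c0] := leP 0 ((1 + c) / 2); [left|right].
    by move: NE; rewrite ger0_norm// => <-.
  by move: NE; rewrite ltr0_norm// => <-.
have h2 : c * Na (u + v) <= 1 /\ - c * Na (u + v) <= 1.
  move: qv; rewrite qc is_normZ// => h.
  split; rewrite (le_trans _ h)// ler_wpM2r ?is_norm_ge0//; first exact: ler_norm.
  by rewrite -normrN; exact: ler_norm.
have N0 := is_norm_ge0 hNa (u + v).
case: h2 => h2 h3; case: h1 => h1; last by nra.
have Np : Na (u + v) = 1 by nra.
by move: h1 h2 c1; rewrite Np !mulr1 => h1 h2 /eqP; apply; lra.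
Qed.

Lemma small_image_ball u (D : R) : Na u = 1 -> ~ extremal (unit_ball Na) u ->
  (0 < m)%N -> 0 < D ->
  exists f0 r, [/\ L f0, 0 < r &
    forall f, L f -> d f0 f < r -> (hausdorff n (f @` @cube R n) <= D%:E)%E].
Proof.
move=> u1 hu m0 D0; have [p [q [p1 q1 pq1 p0 qp]]] := non_extremal_segment u1 hu.
have [b [bL bp bq]] := busemann_function hNa p1 q1 pq1.
have [w [psi [W [[W0 w1] psiB psiw psi_le psi_exposed]]]] := exposed_point m0 hNb.
have [A [i1 [i2 [Au i12 ri1 ri2]]]] := two_vector_basis p0 qp.
have [K K0 fK] := Lip1_norm hNa hNb.
have [CA CA0 AC] := norm_mulmx_le A.
have [M0 M00 AM] := norm_mulmx_le (invmx A).
pose C1 := K * CA + 2 * (W + 1).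
have C10 : 0 < C1 by apply: addr_gt0; rewrite mulr_gt0// addr_gt0.
(* [q1' / L'.+1] is the diameter allotted to each ball. The total cost is [Q] times a sum of three
   terms, brought below [D / 4] by [k], [r] and [L'] respectively. *)
pose q1' := 4 * m%:R * C1 * (M0 + 1).
have q1'0 : 0 <= q1'.
  by rewrite mulr_ge0 ?addr_ge0 ?(ltW M00)// mulr_ge0 ?(ltW C10).
pose Q := q1' ^+ n; have Q0 : 0 <= Q by exact: exprn_ge0.
pose k := (Num.bound (4 * Q / D)).+1.
have k0 : 0 < k%:R :> R by rewrite ltr0n.
have Qk : Q / k%:R <= D / 4.
  have : 4 * Q / D <= k%:R.
    rewrite (le_trans (ltW (archi_boundP _)))// ?ler_nat//.
    by rewrite divr_ge0 ?mulr_ge0// ltW.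
  by rewrite !ler_pdivrMr// => h; lra.
pose r := D / 4 / (4 * k%:R ^+ 2 * (Q + 1) / (M0 + 1)).
have r0 : 0 < r.
  apply: divr_gt0; first exact: divr_gt0.
  by rewrite divr_gt0 ?addr_gt0// mulr_gt0 ?ltr_wpDl// mulr_gt0// exprn_gt0.
have Qr : Q * (4 * k%:R ^+ 2 * r / (M0 + 1)) <= D / 4.
  rewrite (_ : Q * _ = (D / 4) * (Q / (Q + 1))); last first.
    have E (x y z e : R) : x != 0 -> y + 1 != 0 -> z + 1 != 0 ->
        y * (4 * x ^+ 2 * (e / (4 * x ^+ 2 * (y + 1) / (z + 1))) / (z + 1)) =
        e * (y / (y + 1)).
      by move=> ? ? ?; field; apply/and3P.
    have Q1 : Q + 1 != 0 by rewrite gt_eqF// ltr_wpDl.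
    have M1 : M0 + 1 != 0 by rewrite gt_eqF// addr_gt0.
    by rewrite /r E// gt_eqF.
  by rewrite ler_piMr ?divr_ge0 ?(ltW D0)// ler_pdivrMr ?ltr_wpDl// mul1r lerDl.
pose kap := k%:R * (`|row i1 A| + `|row i2 A|) + CA.
have kap0 : 0 < kap by rewrite ltr_wpDl// mulr_ge0// addr_ge0.
have [cs csP] : exists cs : nat, forall i, exists j, kap < cs%:R * `|A j i|.
  have nz i : exists j, A j i != 0.
    apply: contrapT => h; have /matrixP /(_ i i) := mulVmx Au.
    rewrite !mxE eqxx big1 => [/eqP|j _]; first by rewrite eq_sym oner_eq0.
    have [->|Aji] := eqVneq (A j i) 0; first by rewrite mulr0.
    by exfalso; apply: h; exists j.
  have [jf jP] := fin_all_exists nz.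
  exists (Num.bound (\sum_i kap / `|A (jf i) i|)) => i; exists (jf i).
  rewrite -ltr_pdivrMr ?normr_gt0// (le_lt_trans _ (archi_boundP _))//.
    rewrite (bigD1 i)//= lerDl sumr_ge0// => j _; rewrite divr_ge0//.
    exact: ltW.
  by apply: sumr_ge0 => j _; rewrite divr_ge0// ltW.
have bN x y : `|b x - b y| <= Na (x - y).
  by rewrite ler_norml lerNl opprB bL andbT is_norm_distC.
have [Ca Ca0 NaC] := is_norm_le hNa.
pose f0 x := b x *: w.
have Lf0 : L f0.
  split; last first.
    move=> x y _ _; rewrite /f0 -scalerBl is_normZ// (le_trans _ (bN x y))//.
    by rewrite ler_piMr.
  exists (`|b 0| + Ca) => x /cubeE cx; rewrite is_normZ//.
  rewrite (le_trans (_ : _ <= `|b x|))// ?ler_piMr//.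
  rewrite -(subrK (b 0) (b x)) addrC (le_trans (ler_normD _ _))// lerD2l.
  rewrite (le_trans (bN _ _))// subr0 (le_trans (NaC _))// ler_piMr//.
  exact: ltW.
exists f0, r; split=> // f Lf ffr.
apply: ge_ereal_sup => _ [delta /= delta0 <-].
(* [X] controls the third term, from the shells; [Y] brings the diameters below [delta]. *)
pose X := 4 * Q * (1 + n%:R * (2 * cs%:R)) / D.
have X0 : 0 <= X by rewrite divr_ge0 ?(ltW D0)// !mulr_ge0// addr_ge0// !mulr_ge0.
pose Y := q1' / delta; have Y0 : 0 <= Y by rewrite divr_ge0// ltW.
pose L' := Num.bound (X + Y).
have XY : X + Y <= L'.+1%:R.
  by rewrite (le_trans (ltW (archi_boundP _)))// ?addr_ge0// ler_nat.
have L0 : 0 < L'.+1%:R :> R by [].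
pose t : R := 2 * (M0 + 1) / L'.+1%:R.
have t0 : 0 < t by rewrite divr_gt0// mulr_gt0// addr_gt0.
have fr x : cube x -> Nb (f x - b x *: w) <= r.
  by move=> cx; rewrite is_norm_distC// (le_trans _ (ltW ffr))// (supdist_ub hNb Lf0).
have bp' x s : b (x + s *: row i1 A) = b x + s by rewrite ri1.
have bq' x s : b (x + s *: row i2 A) = b x + s by rewrite ri2.
have p1' : Na (row i1 A) <= 1 by rewrite ri1.
have q1'' : Na (row i2 A) <= 1 by rewrite ri2.
have [s [sL scov]] := lattice_cover hNa hNb W0 psiB psiw psi_le psi_exposed Au i12
  p1' q1'' bp' bq' Lf fr CA0 M00 K0 (fK _ Lf) AC AM L' (isT : (0 < k)%N) csP.
have q1't : 2 * m%:R * (C1 * t) = q1' / L'.+1%:R.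
  by rewrite /t /q1'; move: (L'.+1%:R) => x; ring.
apply: (@le_trans _ _ ((size s)%:R * (2 * m%:R * (C1 * t)) ^+ n)%:E).
  apply: hausdorff_pre_ball_cover.
  - by rewrite mulr_ge0// ltW.
  - rewrite q1't ler_pdivrMr// mulrC -ler_pdivrMr// (le_trans _ XY)//.
    by rewrite lerDr.
  - by move=> _ [x cx <-]; exact: scov.
rewrite lee_fin q1't exprMn -/Q exprVn.
set c := (X in _ <= X * _) in sL.
have ssL : (size s)%:R / L'.+1%:R ^+ n <= c / L'.+1%:R.
  rewrite ler_pdivrMr ?exprn_gt0// mulrAC ler_pdivlMr// mulrC.
  by rewrite mulrC [leLHS]mulrC.
rewrite mulrCA; apply: (@le_trans _ _ (Q * (c / L'.+1%:R))).
  by rewrite ler_wpM2l.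
have -> : c / L'.+1%:R = k%:R^-1 + 4 * k%:R ^+ 2 * r / (M0 + 1) +
    (1 + n%:R * (2 * cs%:R)) / L'.+1%:R.
  rewrite /c; move: (L'.+1%:R) L0 => l l0; move: (r) => r'; field.
  by rewrite !gt_eqF// addr_gt0.
have QX : Q * ((1 + n%:R * (2 * cs%:R)) / L'.+1%:R) <= D / 4.
  rewrite -(ler_pM2r L0) -mulrA divfK ?gt_eqF//.
  have : X <= L'.+1%:R by rewrite (le_trans _ XY)// lerDl.
  have aux (x a y l : R) : 4 * x * a <= l * y -> x * a <= y / 4 * l by lra.
  by rewrite /X ler_pdivrMr// => h; exact: aux.
rewrite mulrDr [Q * (_ + _)]mulrDr.
by apply: le_trans (lerD (lerD Qk Qr) QX) _; move: D0; lra.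
Qed.

End SmallImages.

(** * Baire's theorem for 1-Lipschitz maps *)

Section Baire.
Variables (R : realType) (n m : nat).
Variables (Na : 'rV[R]_n -> R) (Nb : 'rV[R]_m -> R).
Hypotheses (hNa : is_norm Na) (hNb : is_norm Nb).
Local Notation L := (Lip1 Na Nb).
Local Notation d := (@supdist R n m Nb).

Lemma supdist_triangle f g h : L f -> L g -> L h -> d f h <= d f g + d g h.
Proof.
move=> Lf Lg Lh; apply: supdist_le => x cx.
rewrite (le_trans (is_norm_distD hNb (g x) _ _))// lerD//.
  exact: (supdist_ub hNb Lf Lg).
exact: (supdist_ub hNb Lg Lh).
Qed.

(* The limit is found coordinatewise, as a supremum. *)
Lemma nested_balls_meet (v : nat -> 'rV[R]_m) (e : nat -> R) :
  (forall i, 0 < e i) ->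
  (forall eps, 0 < eps -> exists j, forall i, (j <= i)%N -> e i < eps) ->
  (forall i j, (i <= j)%N -> Nb (v i - v j) + e j <= e i) ->
  exists l, forall k, Nb (v k - l) <= e k.
Proof.
move=> e_gt0 e0 ve; have [c c0 Nc] := is_norm_ge hNb; have [C C0 NC] := is_norm_le hNb.
have vc i j q : (i <= j)%N -> c * `|v i ord0 q - v j ord0 q| + e j <= e i.
  move=> ij; rewrite (le_trans _ (ve _ _ ij))// lerD2r (le_trans _ (Nc _))//.
  by rewrite ler_pM2l//; have := coord_le_norm (v i - v j) q; rewrite !mxE.
pose lo q i := c * v i ord0 q - e i.
have lohi q i j : lo q i <= c * v j ord0 q + e j.
  have := e_gt0 j; have := e_gt0 i; rewrite /lo; have [ij|/ltnW ji] := leqP i j.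
    have := vc i j q ij; have := ler_norm (v i ord0 q - v j ord0 q).
    by rewrite -(ler_pM2l c0); lra.
  have := vc j i q ji; have := ler_norm (- (v j ord0 q - v i ord0 q)).
  by rewrite normrN -(ler_pM2l c0); lra.
pose l := \row_q (c^-1 * sup (range (lo q))).
have lk k : `|v k - l| <= c^-1 * e k.
  apply: norm_le_coord => [|q]; first by rewrite mulr_ge0 ?invr_ge0 ?ltW.
  rewrite !mxE -[v k ord0 q](mulKf (lt0r_neq0 c0)) -mulrBr normrM.
  rewrite gtr0_norm ?invr_gt0// ler_pM2l ?invr_gt0//.
  have s1 : lo q k <= sup (range (lo q)).
    by apply: ub_le_sup; [exists (c * v k ord0 q + e k) => _ [i _ <-] | exists k].
  have s2 : sup (range (lo q)) <= c * v k ord0 q + e k.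
    by apply: ge_sup; [exists (lo q k), k | move=> _ [i _ <-]].
  by move: s1; rewrite /lo ler_norml => s1; apply/andP; lra.
exists l => k; apply/ler_addgt0Pr => eps eps0.
have [j je] := e0 (eps * c / C) (divr_gt0 (mulr_gt0 eps0 c0) C0).
pose i := maxn j k; have ei := je i (leq_maxl _ _).
rewrite (le_trans (is_norm_distD hNb (v i) _ _))//.
have vki := ve k i (leq_maxr _ _).
have vil : Nb (v i - l) <= eps.
  rewrite (le_trans (NC _))// mulrC -ler_pdivlMr// (le_trans (lk i))//.
  by rewrite mulrC ler_pdivrMr// mulrAC ltW.
by have := e_gt0 i; lra.
Qed.

(** Nesting in the form distance plus new radius at most old radius passes to the values at each
    point, so the limit is built pointwise. *)
Lemma Lip1_baire (U : nat -> set ('rV[R]_n -> 'rV[R]_m)) f0 r0 :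
  (forall k, open_in L d (U k) /\ dense_in L d (U k)) -> L f0 -> 0 < r0 ->
  exists f, [/\ L f, d f0 f <= r0 & forall k, U k f].
Proof.
move=> Uod Lf0 r00; pose state := (('rV[R]_n -> 'rV[R]_m) * R)%type.
pose good (x : state) := L x.1 /\ 0 < x.2.
have step (kx : nat * state) : exists y : state, good kx.2 ->
    [/\ good y, y.2 <= kx.2.2 / 2, d kx.2.1 y.1 + y.2 <= kx.2.2 &
        forall h, L h -> d y.1 h <= y.2 -> U kx.1 h].
  case: kx => k [f r] /=; have [[/= Lf rp]|ng] := pselect (good (f, r)); last first.
    by exists (f, r) => /ng.
  have [[UL Uo] [_ Ud]] := Uod k.
  have [g [Ug fg]] := Ud f Lf (r / 2) (divr_gt0 rp (ltr0n _ 2)).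
  have [rho rho0 Urho] := Uo g Ug.
  exists (g, Num.min (rho / 2) (r / 2)) => _; split=> /=.
  - by split=> /=; [exact: UL | rewrite lt_min !divr_gt0].
  - by rewrite ge_min lexx orbT.
  - have : Num.min (rho / 2) (r / 2) <= r / 2 by rewrite ge_min lexx orbT.
    by move: fg; lra.
  - move=> h Lh gh; apply: Urho => //; apply: le_lt_trans gh _.
    by rewrite gt_min ltr_pdivrMr// ltr_pMr// ltr1n.
have [next nextP] := choice step.
pose x := fix x k := if k is j.+1 then next (j, x j) else (f0, r0).
have xgood k : good (x k).
  by elim: k => [|k IH] //=; have [] := nextP (k, x k) IH.
have xL k : L (x k).1 by have [] := xgood k.
have xp k : 0 < (x k).2 by have [] := xgood k.
have xS k : [/\ (x k.+1).2 <= (x k).2 / 2, d (x k).1 (x k.+1).1 + (x k.+1).2 <= (x k).2 &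
    forall h, L h -> d (x k.+1).1 h <= (x k.+1).2 -> U k h].
  by have [] := nextP (k, x k) (xgood k).
have xd i j : (i <= j)%N -> d (x i).1 (x j).1 + (x j).2 <= (x i).2.
  elim: j => [|j IH].
    rewrite leqn0 => /eqP ->; rewrite gerDr.
    by apply: supdist_le => y _; rewrite subrr is_norm0.
  rewrite leq_eqVlt => /orP[/eqP <-|].
    rewrite gerDr; apply: supdist_le => y _.
    by rewrite subrr is_norm0.
  rewrite ltnS => /IH {}IH; have [_ xj _] := xS j.
  by have := supdist_triangle (xL i) (xL j) (xL j.+1); lra.
have x0 eps : 0 < eps -> exists j, forall i, (j <= i)%N -> (x i).2 < eps.
  (* Halving implies a harmonic bound, which reduces convergence to the Archimedean property. *)
  move=> eps0; have xi i : (x i).2 * i.+1%:R <= r0.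
    elim: i => [|i IH]; first by rewrite mulr1.
    rewrite (le_trans _ IH)//; have [xi _ _] := xS i.
    apply: (@le_trans _ _ ((x i).2 / 2 * i.+2%:R)); first by rewrite ler_pM2r.
    rewrite -mulrA ler_pM2l// mulrC ler_pdivrMr// -natrM ler_nat; lia.
  exists (Num.bound (r0 / eps)) => i ji.
  have : r0 / eps < i.+1%:R.
    have re0 : 0 <= r0 / eps by rewrite divr_ge0// ltW.
    by rewrite (lt_le_trans (archi_boundP re0))// ler_nat leqW.
  rewrite ltr_pdivrMr// => h; have := le_lt_trans (xi i) h.
  by rewrite [_ * eps]mulrC ltr_pM2r.
have lim y : exists l, cube y -> forall k, Nb ((x k).1 y - l) <= (x k).2.
  have [cy|ncy] := pselect (cube y); last by exists 0.
  have [l lP] : exists l, forall k, Nb ((x k).1 y - l) <= (x k).2.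
    apply: (nested_balls_meet xp x0) => i j ij; rewrite (le_trans _ (xd _ _ ij))//.
    by rewrite lerD2r (supdist_ub hNb (xL i)).
  by exists l.
have [f fP] := choice lim.
have Lf : L f.
  split.
    have [[M fM] _] := Lf0; exists (M + r0) => y cy.
    rewrite -(subrK ((x 0%N).1 y) (f y)) addrC (le_trans (is_normD hNb _ _))//.
    by rewrite lerD ?fM// is_norm_distC// (fP _ cy 0%N).
  move=> y z cy cz; apply/ler_addgt0Pr => eps eps0.
  have [j xj] := x0 (eps / 2) (divr_gt0 eps0 (ltr0n _ 2)).
  have := xj j (leqnn j); have := fP _ cy j; have := fP _ cz j.
  have := (xL j).2 _ _ cy cz.
  have := is_norm_distD hNb ((x j).1 y) (f y) (f z).
  have := is_norm_distD hNb ((x j).1 z) ((x j).1 y) (f z).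
  by rewrite (is_norm_distC hNb (f y) ((x j).1 y)); lra.
have df k : d (x k).1 f <= (x k).2 by apply: supdist_le => y cy; exact: fP.
exists f; split=> //; first exact: (df 0%N).
by move=> k; have [_ _] := xS k; apply.
Qed.

End Baire.

Theorem theorem1p2 (R : realType) (n m : nat)
  (Na : 'rV[R]_n -> R) (Nb : 'rV[R]_m -> R) (Delta : R) :
  is_norm Na ->
  (exists u, Na u = 1 /\ ~ extremal (unit_ball Na) u) ->
  (n <= m)%N ->
  is_norm Nb ->
  0 <= Delta ->
  (residual_in (Lip1 Na Nb) (supdist Nb)
     [set f | Lip1 Na Nb f /\ (Delta%:E < hausdorff n (f @` @cube R n))%E]
   <-> Delta = 0).

Proof.
move=> hNa [u [u1 hu]] nm hNb D0.
case: n Na hNa u u1 hu nm => [|p] Na' hNa u u1 hu nm.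
  (* In dimension 0 there is no unit vector. *)
  by move: u1; rewrite (thinmx0 u) is_norm0// => /eqP; rewrite eq_sym oner_eq0.
have m0 : (0 < m)%N by exact: leq_trans nm.
split=> [[U [Uod US]]|->].
  apply: contrapT => /eqP Dn0; have Dp : 0 < Delta by rewrite lt_def Dn0.
  have [f0 [r [Lf0 r0 small]]] := small_image_ball hNa hNb u1 hu m0 Dp.
  (* Half the radius turns the closed ball of [Lip1_baire] into a part of the open one. *)
  have [f [Lf ff Uf]] := Lip1_baire hNb Uod Lf0 (divr_gt0 r0 (ltr0n _ 2)).
  have [|_] := US f; first by move=> k _; exact: Uf.
  apply/negP; rewrite -leNgt; apply: small => //.
  by rewrite (le_lt_trans ff)// ltr_pdivrMr// ltr_pMr// ltr1n.
have [K K0 fK] := Lip1_norm hNa hNb.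
(* A single open dense set, repeated. *)
exists (fun=> [set f | Lip1 Na' Nb f /\ nondegenerate f]); split=> [_|f].
  split; split=> [f []//|f].
    move=> [Lf /(nondegenerate_open hNb Lf)[r r0 fr]].
    by exists r => // g Lg fg; split=> //; exact: fr.
  move=> Lf r r0; have [g [Lg gn fg]] := nondegenerate_dense hNa hNb nm Lf r0.
  by exists g.
move=> /(_ 0%N Logic.I)[Lf fn]; split=> //.
exact: (hausdorff_gt0 K0 (fK f Lf) fn).
Qed.
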